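(* Let $m\ge1$ be an integer and suppose that $g\in L^2_a(\mathbb{D})$ satisfies $g(0)=g'(0)=\cdots=g^{(m-1)}(0)=0$. Then, for $z \in \mathbb{D}\setminus\{0\}$, $$T^*_{z^m}g(z)=\frac{1}{z^{m+1}}\int_0^z\big[wg'(w)-(m-1)g(w)\big]\,dw=\frac{1}{z^m}g(z)-\frac{m}{z^{m+1}}\int_0^zg(w)\,dw.$$
   Context: $\mathbb{D}$ is the open unit disk in $\mathbb{C}$ and $dA$ is the normalized Lebesgue area measure on $\mathbb{D}$. The Bergman space $L^2_a(\mathbb{D})$ is the closed subspace of analytic functions in $L^2(\mathbb{D},dA)$, and $P:L^2(\mathbb{D},dA)\to L^2_a(\mathbb{D})$ is the orthogonal projection. For $\varphi\in L^\infty(\mathbb{D},dA)$ the Toeplitz operator is $T_\varphi f=P(\varphi f)$ on $L^2_a(\mathbb{D})$, and $T_\varphi^*=T_{\overline{\varphi}}$; in particular $T^*_{z^m}=T_{\overline{z}^m}$. At $z=0$ the right-hand sides are understood via removable singularities. *)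

(* Defs.v *)
From HB Require Import structures.
From mathcomp Require Import all_boot all_order all_algebra.
From mathcomp Require Import complex.
From mathcomp Require Import all_classical all_reals all_analysis.

Set Implicit Arguments.
Unset Strict Implicit.
Unset Printing Implicit Defensive.

Import Order.TTheory GRing.Theory Num.Theory.
Import numFieldNormedType.Exports.

Local Open Scope classical_set_scope.
Local Open Scope ring_scope.

(* [R[i]] packed as a [numClosedFieldType]: this selects the normed-module
   structure of the complex numbers over themselves, so that [derivable],
   [derive1] and [derive1n] at this type are complex derivatives. *)
Definition Cplx (R : realType) : numClosedFieldType := R[i].

(* The real plane with its Borel sets. *)
Definition plane (R : realType) : measurableType _ :=
  (measurableTypeR R * measurableTypeR R)%type.

Section Bergman.
Variable R : realType.
Local Notation C := (Cplx R).

Definition cRe (z : C) : R := complex.Re (z : R[i]).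
Definition cIm (z : C) : R := complex.Im (z : R[i]).
Definition cplx_of_real (t : R) : C := real_complex R t.
Definition cplx_of_plane (p : plane R) : C := Complex p.1 p.2.

Definition cintegral d (T : measurableType d) (mu : {measure set T -> \bar R})
    (D : set T) (f : T -> C) : C :=
  Complex (Rintegral mu D (cRe \o f)) (Rintegral mu D (cIm \o f)).

(* [\int_0^z f(w) dw], along the segment w = t z with 0 <= t <= 1 *)
Definition segment_integral (f : C -> C) (z : C) : C :=
  cintegral (@lebesgue_measure R) `[0, 1]
    (fun t : R => f (cplx_of_real t * z) * z).

Definition disk : set C := [set z | `|z| < 1].
Definition plane_disk : set (plane R) := cplx_of_plane @^-1` disk.

Definition pi_inv : {nonneg R} := NngNum (ltW (eqbRL (invr_gt0 pi) (pi_gt0 R))).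

Definition dA : {measure set plane R -> \bar R} :=
  mscale pi_inv (product_measure1 (@lebesgue_measure R) (@lebesgue_measure R)).

(* Functions are total on the complex plane; only their values on the disk
   matter. *)
Definition L2_disk : set (C -> C) := [set f : C -> C |
  [/\ measurable_fun plane_disk (cRe \o f \o cplx_of_plane),
      measurable_fun plane_disk (cIm \o f \o cplx_of_plane)
    & (\int[dA]_(p in plane_disk)
        (cRe (`|f (cplx_of_plane p)| ^+ 2))%:E < +oo)%E]].

Definition inner (f g : C -> C) : C :=
  cintegral dA plane_disk
    (fun p => f (cplx_of_plane p) * (g (cplx_of_plane p))^*).

Definition bergman : set (C -> C) :=
  [set f : C -> C | L2_disk f /\ forall z, disk z -> derivable f z 1].

(* Orthogonal projection of L^2 onto the Bergman space: [h] is the element of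
   the Bergman space such that f - h is orthogonal to the Bergman space. It is
   unique as a function on the disk; the values outside the disk are
   arbitrary. *)
Definition bergman_proj (f : C -> C) : C -> C :=
  xget (fun=> 0) [set h : C -> C | bergman h /\
    forall k, bergman k -> inner (fun z => f z - h z) k = 0].

Definition toeplitz (phi f : C -> C) : C -> C :=
  bergman_proj (fun z => phi z * f z).

(* Hilbert-space adjoint of an operator on the Bergman space; with the same
   proviso on the values outside the disk. *)
Definition adjoint (A : (C -> C) -> (C -> C)) (g : C -> C) : C -> C :=
  xget (fun=> 0) [set h : C -> C | bergman h /\
    forall f, bergman f -> inner (A f) g = inner f h].

End Bergman.

Arguments disk {R}.
Arguments bergman {R}.

(* Main.v *)
(* Write g = z^m q with q holomorphic, put S(z) = \int_0^1 t^m q(tz) dt and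
   h = q - m S; then \int_0^z g = z^(m+1) S, so that h is the claimed value of
   T*_{z^m} g.  With Q = z S one has Q' = h and (z^m Q)' = g, hence for every
   holomorphic f the function f conj(Q) (|z|^(2m) - rho^(2m)) vanishes on the
   circle |z| = rho, and its d-bar derivative has integral 0 over |z| < rho:
     \int_{|z|<rho} z^m f conj(g) = rho^(2m) \int_{|z|<rho} f conj(h).
   Taking f = h bounds the L^2 norm of h, and rho -> 1 gives the adjoint
   relation.  This uses neither power series nor polar coordinates.

   Regularity comes from Goursat's lemma on rectangles applied to
   w |-> f(z + e^w) e^(-w), which is 2 pi i-periodic: this yields
     2 pi f'(z) = \int_0^(2 pi) f(z + r e^(iy)) e^(-iy) / r dy,
   so that f' is locally Lipschitz, then differentiable under the integral. *)
Require Import Defs.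
From HB Require Import structures.
From mathcomp Require Import all_boot all_order all_algebra.
From mathcomp Require Import complex ring lra.
From mathcomp Require Import all_classical all_reals all_analysis.
From mathcomp Require Import measurable_realfun.
Set Implicit Arguments.
Unset Strict Implicit.
Unset Printing Implicit Defensive.
Import Order.TTheory GRing.Theory Num.Theory.
Import numFieldNormedType.Exports.
Local Open Scope classical_set_scope.
Local Open Scope ring_scope.

(** * Complex numbers and complex derivatives *)

(** Membership of g in the Bergman space gives a complex derivative at each point of the disk and
    says nothing about its continuity. Dividing by z uses the quotient \int_0^1 g'(tz) dt, which
    makes sense and is again holomorphic only once g' is known to be holomorphic, and this division
    is repeated m times. Hence the regularity theory.

    Q is chosen so that z^m Q is the primitive of g that vanishes at 0. The d-bar derivative of f
    conj(Q) (z^m conj(z^m) - rho^(2m)) is then z^m f conj((z^m Q)') - rho^(2m) f conj(Q'), and since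
    the weight is zero on the circle there is no boundary term: Fubini and the fundamental theorem
    of calculus on chords suffice.

    A priori h is only holomorphic, so f = h is inserted on |z| < rho, where everything is bounded;
    a weighted inequality between means absorbs the integral of |h|^2, with constants uniform for
    rho >= 1/2.

    [bergman_proj] and [adjoint] are choices among candidates. Each receives an explicit witness,
    z^m f and h respectively, and two candidates differ by a Bergman function orthogonal to itself,
    which vanishes on the disk. *)

Lemma is_derive_epsP (K : numFieldType) (f : K -> K) (z d : K) :
  is_derive z 1 f d <->
  forall e, 0 < e -> exists2 r, 0 < r &
    forall h, `|h| < r -> `|f (z + h) - f z - h * d| <= e * `|h|.
Proof.
split=> [[df dE] e e0|H].
  have : (fun h => h^-1 *: ((f \o shift z) (h *: 1) - f z)) @ 0^' --> d.
    by rewrite -dE; exact: df.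
  move/cvgrPdist_le => /(_ e e0).
  rewrite near_withinE => /nbhs_ballP[r /= r0 Hr].
  exists r => // h hr.
  have [->|h0] := eqVneq h 0.
    by rewrite addr0 subrr mul0r subrr normr0 mulr0.
  have := Hr h; rewrite /ball /= sub0r normrN => /(_ hr h0).
  rewrite /shift /= /GRing.scale /= mulr1 => He.
  have -> : f (z + h) - f z - h * d = - (h * (d - h^-1 * (f (h + z) - f z))).
    by rewrite mulrBr mulrA divff// mul1r opprB [h + z]addrC.
  by rewrite normrN normrM mulrC ler_pM2r// normr_gt0.
have cv : (fun h => h^-1 *: ((f \o shift z) (h *: 1) - f z)) @ 0^' --> d.
  apply/cvgrPdist_le => e e0.
  have [r r0 Hr] := H e e0.
  rewrite near_withinE; apply/nbhs_ballP; exists r => //= h.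
  rewrite /ball /= sub0r normrN => hr h0.
  rewrite /shift /= /GRing.scale /= mulr1.
  have := Hr h hr.
  have -> : f (z + h) - f z - h * d = - (h * (d - h^-1 * (f (h + z) - f z))).
    by rewrite mulrBr mulrA divff// mul1r opprB [h + z]addrC.
  by rewrite normrN normrM mulrC ler_pM2r// normr_gt0.
split.
  by apply/cvg_ex; exists d.
exact: (cvg_lim (@norm_hausdorff _ _) cv).
Qed.

Section Basics.
Variable R : realType.
Local Notation C := (Cplx R).
Implicit Types z w : C.

(** The norm of [C] takes its values in [C]. This real-valued copy lets estimates be carried out in
    the ordered field [R]. *)
Definition cnorm z : R := cRe `|z|.

Lemma normE z : `|z| = cplx_of_real (cnorm z).
Proof. by rewrite /cnorm /cplx_of_real (normc_def (z : R[i])). Qed.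

Lemma cnormE z : cnorm z = Num.sqrt (cRe z ^+ 2 + cIm z ^+ 2).
Proof. by rewrite /cnorm (normc_def (z : R[i])). Qed.

Lemma cplx_of_real_inj : injective (@cplx_of_real R).
Proof. exact: complexI. Qed.

Lemma cplxD (a b : R) : cplx_of_real (a + b) = cplx_of_real a + cplx_of_real b.
Proof. exact: (rmorphD (real_complex R)). Qed.
Lemma cplxB (a b : R) : cplx_of_real (a - b) = cplx_of_real a - cplx_of_real b.
Proof. exact: (rmorphB (real_complex R)). Qed.
Lemma cplxM (a b : R) : cplx_of_real (a * b) = cplx_of_real a * cplx_of_real b.
Proof. exact: (rmorphM (real_complex R)). Qed.
Lemma cplxX (a : R) n : cplx_of_real (a ^+ n) = cplx_of_real a ^+ n.
Proof. exact: (rmorphXn (real_complex R)). Qed.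
Lemma cplx0 : cplx_of_real 0 = 0 :> C.
Proof. by []. Qed.
Lemma cplx1 : cplx_of_real 1 = 1 :> C.
Proof. by []. Qed.
Lemma ltcplx (a b : R) : (cplx_of_real a < cplx_of_real b) = (a < b).
Proof. exact: ltcR. Qed.
Lemma lecplx (a b : R) : (cplx_of_real a <= cplx_of_real b) = (a <= b).
Proof. exact: lecR. Qed.

Lemma cRe_real (a : R) : cRe (cplx_of_real a) = a. Proof. by []. Qed.
Lemma cIm_real (a : R) : cIm (cplx_of_real a) = 0. Proof. by []. Qed.
Lemma cReD z w : cRe (z + w) = cRe z + cRe w. Proof. by case: z w => [a b][c d]. Qed.
Lemma cImD z w : cIm (z + w) = cIm z + cIm w. Proof. by case: z w => [a b][c d]. Qed.
Lemma cReN z : cRe (- z) = - cRe z. Proof. by case: z. Qed.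
Lemma cImN z : cIm (- z) = - cIm z. Proof. by case: z. Qed.
Lemma cReB z w : cRe (z - w) = cRe z - cRe w. Proof. by case: z w => [a b][c d]. Qed.
Lemma cImB z w : cIm (z - w) = cIm z - cIm w. Proof. by case: z w => [a b][c d]. Qed.
Lemma cReM z w : cRe (z * w) = cRe z * cRe w - cIm z * cIm w.
Proof. by case: z w => [a b][c d]. Qed.
Lemma cImM z w : cIm (z * w) = cRe z * cIm w + cIm z * cRe w.
Proof. by case: z w => [a b][c d]. Qed.
Lemma cRe_conj z : cRe z^* = cRe z. Proof. by case: z. Qed.
Lemma cIm_conj z : cIm z^* = - cIm z. Proof. by case: z. Qed.

Lemma cplxP z w : cRe z = cRe w -> cIm z = cIm w -> z = w.
Proof. by case: z w => [a b][c d] /= -> ->. Qed.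

(** The order on [C] compares only numbers with the same imaginary part, so every positive radius or
    epsilon in [C] is a real number. *)
Lemma cplx_of_real_pos (e : C) : 0 < e -> e = cplx_of_real (cRe e) /\ 0 < cRe e.
Proof. by case: e => a b; rewrite ltcE /= => /andP[/eqP -> ?]; split. Qed.

Lemma cnorm_ge0 z : 0 <= cnorm z.
Proof. by rewrite -lecplx -normE cplx0. Qed.

Lemma cnormD z w : cnorm (z + w) <= cnorm z + cnorm w.
Proof. by rewrite -lecplx cplxD -!normE ler_normD. Qed.

Lemma cnormM z w : cnorm (z * w) = cnorm z * cnorm w.
Proof. by apply: cplx_of_real_inj; rewrite cplxM -!normE normrM. Qed.

Lemma cnormX z n : cnorm (z ^+ n) = cnorm z ^+ n.
Proof. by apply: cplx_of_real_inj; rewrite cplxX -!normE normrX. Qed.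

Lemma cnormN z : cnorm (- z) = cnorm z.
Proof. by rewrite /cnorm normrN. Qed.

Lemma cnormB z w : cnorm (z - w) <= cnorm z + cnorm w.
Proof. by rewrite -[cnorm w]cnormN cnormD. Qed.

Lemma cdistC z w : cnorm (z - w) = cnorm (w - z).
Proof. by rewrite -opprB cnormN. Qed.

Lemma cnorm_conj z : cnorm z^* = cnorm z.
Proof. by rewrite /cnorm norm_conjC. Qed.

Lemma cnorm0 : cnorm 0 = 0.
Proof. by rewrite /cnorm normr0. Qed.

Lemma cnorm1 : cnorm 1 = 1.
Proof. by rewrite /cnorm normr1. Qed.

Lemma cnorm_eq0 z : (cnorm z == 0) = (z == 0).
Proof.
apply/eqP/eqP => [z0|->]; last exact: cnorm0.
by apply/eqP; rewrite -[_ == _]normr_eq0; apply/eqP; rewrite normE z0.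
Qed.

Lemma cnormV z : cnorm z^-1 = (cnorm z)^-1.
Proof.
have [->|z0] := eqVneq z 0; first by rewrite !invr0 cnorm0 invr0.
apply: (mulfI (x := cnorm z)); first by rewrite cnorm_eq0.
by rewrite -cnormM !divff ?cnorm1// cnorm_eq0.
Qed.

Lemma cnorm_real (a : R) : cnorm (cplx_of_real a) = `|a|.
Proof. by rewrite cnormE cRe_real cIm_real expr0n addr0 sqrtr_sqr. Qed.

Lemma cnorm_sqr z : cnorm z ^+ 2 = cRe z ^+ 2 + cIm z ^+ 2.
Proof. by rewrite cnormE sqr_sqrtr// addr_ge0// sqr_ge0. Qed.

Lemma cRe_le z : `|cRe z| <= cnorm z.
Proof.
by rewrite cnormE -sqrtr_sqr ler_wsqrtr// lerDl sqr_ge0.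
Qed.

Lemma cIm_le z : `|cIm z| <= cnorm z.
Proof.
by rewrite cnormE -sqrtr_sqr ler_wsqrtr// lerDr sqr_ge0.
Qed.

Lemma cnorm_le z : cnorm z <= `|cRe z| + `|cIm z|.
Proof.
rewrite cnormE -[leRHS]ger0_norm ?addr_ge0// -sqrtr_sqr ler_wsqrtr//.
rewrite sqrrD !real_normK ?num_real// -addrA lerD2l lerDr.
by rewrite mulrn_wge0// mulr_ge0.
Qed.

Lemma diskE z : disk z <-> cnorm z < 1.
Proof. by rewrite /disk /= normE -cplx1 ltcplx. Qed.

Lemma mulr_conjE z : z * z^* = cplx_of_real (cnorm z ^+ 2).
Proof. by rewrite -normCK normE cplxX. Qed.

(** The expansion avoids the difference quotient, so the increment 0 needs no separate case and the
    same shape serves for real and for complex increments. *)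
Definition has_cderiv (f : C -> C) z d := forall e : R, 0 < e ->
  exists2 r : R, 0 < r & forall h, cnorm h < r ->
    cnorm (f (z + h) - f z - h * d) <= e * cnorm h.

Lemma has_cderivP f z d : is_derive z (1 : C) f d <-> has_cderiv f z d.
Proof.
rewrite is_derive_epsP; split => H e e0.
  have [|r r0 Hr] := H (cplx_of_real e); first by rewrite -cplx0 ltcplx.
  have [rE r0'] := cplx_of_real_pos r0.
  exists (cRe r) => // h hr.
  by rewrite -lecplx cplxM -!normE Hr// normE rE ltcplx.
have [eE e0'] := cplx_of_real_pos e0.
have [r r0 Hr] := H _ e0'.
exists (cplx_of_real r); first by rewrite -cplx0 ltcplx.
move=> h; rewrite !normE ltcplx => /Hr.
by rewrite {2}eE -cplxM lecplx.
Qed.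

Lemma derivable_has_cderiv f z : derivable f z (1 : C) ->
  has_cderiv f z (derive1 f z).
Proof. by move=> df; apply/has_cderivP; rewrite derive1E; exact: derivableP. Qed.

Lemma has_cderiv_derivable f z d : has_cderiv f z d ->
  derivable f z (1 : C) /\ derive1 f z = d.
Proof. by move=> /has_cderivP[df <-]; rewrite derive1E. Qed.

Lemma continuousCP (f : C -> C) z : {for z, continuous f} <->
  forall e : R, 0 < e -> exists2 r : R, 0 < r &
    forall w, cnorm (w - z) < r -> cnorm (f w - f z) < e.
Proof.
split.
  move=> /cvgrPdist_lt cf e e0.
  have [|r /= r0 Hr] := cf (cplx_of_real e); first by rewrite -cplx0 ltcplx.
  have [rE r0'] := cplx_of_real_pos r0.
  exists (cRe r) => // w wr.
  rewrite -ltcplx -normE distrC; apply: Hr => /=.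
  by rewrite distrC normE rE ltcplx.
move=> H; apply/(@cvgrPdist_lt _ _ _ (nbhs z)) => e e0.
have [eE e0'] := cplx_of_real_pos e0.
have [r r0 Hr] := H _ e0'.
apply/nbhs_ballP; exists (cplx_of_real r); first by rewrite /= -cplx0 ltcplx.
move=> w /=; rewrite /ball /= distrC normE ltcplx => /Hr.
by rewrite distrC normE {2}eE ltcplx.
Qed.

Lemma has_cderiv_continuous f z d : has_cderiv f z d -> {for z, continuous f}.
Proof.
move=> /has_cderivP[df _].
by apply: differentiable_continuous; apply/derivable1_diffP.
Qed.

Lemma cvgC (T : Type) (F : set_system T) (FF : Filter F) (g : T -> C) (l : C) :
  (fun x => cRe (g x)) @ F --> cRe l -> (fun x => cIm (g x)) @ F --> cIm l ->
  g @ F --> l.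
Proof.
move=> /cvgrPdist_lt Hr /cvgrPdist_lt Hi; apply/cvgrPdist_lt => e e0.
have [eE e0'] := cplx_of_real_pos e0.
have e2 : 0 < cRe e / 2 by rewrite divr_gt0.
near=> x; rewrite normE eE ltcplx (le_lt_trans (cnorm_le _))//.
rewrite cReB cImB [ltRHS]splitr ltrD//.
  by near: x; exact: Hr.
by near: x; exact: Hi.
Unshelve. all: by end_near. Qed.

Lemma cvg_cRe (T : Type) (F : set_system T) (FF : Filter F) (g : T -> C) (l : C) :
  g @ F --> l -> (fun x => cRe (g x)) @ F --> cRe l.
Proof.
move=> /cvgrPdist_lt Hg; apply/cvgrPdist_lt => e e0.
have e0' : 0 < cplx_of_real e by rewrite -cplx0 ltcplx.
near=> x; rewrite -cReB (le_lt_trans (cRe_le _))//.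
by rewrite -ltcplx -normE; near: x; exact: Hg.
Unshelve. all: by end_near. Qed.

Lemma cvg_cIm (T : Type) (F : set_system T) (FF : Filter F) (g : T -> C) (l : C) :
  g @ F --> l -> (fun x => cIm (g x)) @ F --> cIm l.
Proof.
move=> /cvgrPdist_lt Hg; apply/cvgrPdist_lt => e e0.
have e0' : 0 < cplx_of_real e by rewrite -cplx0 ltcplx.
near=> x; rewrite -cImB (le_lt_trans (cIm_le _))//.
by rewrite -ltcplx -normE; near: x; exact: Hg.
Unshelve. all: by end_near. Qed.

Lemma cvg_conj (T : Type) (F : set_system T) (FF : Filter F) (g : T -> C) (l : C) :
  g @ F --> l -> (fun x => (g x)^*) @ F --> l^*.
Proof.
move=> gl; apply: cvgC; rewrite ?cRe_conj ?cIm_conj.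
  under eq_fun do rewrite cRe_conj; exact: cvg_cRe.
under eq_fun do rewrite cIm_conj; apply: cvgN; exact: cvg_cIm.
Qed.

End Basics.

(** * Paths in the plane *)

Section Chain.
Variable R : realType.
Local Notation C := (Cplx R).

(** One chain rule for two kinds of inner function: [X] is [C] for composition of complex functions
    and [R] for a path followed by a complex function. [N] is the norm on [X], and [L] is the
    derivative of [G] at [t] as a map of the increment, with operator bound [K]. *)
Lemma expand_chain (X : zmodType) (N : X -> R) (G L : X -> C) (K : R) (f : C -> C)
    (t : X) (d : C) :
  (forall h, 0 <= N h) -> (forall h, cnorm (L h) <= K * N h) -> 0 <= K ->
  (forall e : R, 0 < e -> exists2 r : R, 0 < r &
    forall h, N h < r -> cnorm (G (t + h) - G t - L h) <= e * N h) ->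
  has_cderiv f (G t) d ->
  forall e : R, 0 < e -> exists2 r : R, 0 < r &
    forall h, N h < r -> cnorm (f (G (t + h)) - f (G t) - L h * d) <= e * N h.
Proof.
move=> N0 LK K0 HG Hf e e0.
have K1 : 0 < K + 1 by lra.
have d1 : 0 < cnorm d + 1 by have := cnorm_ge0 d; lra.
have [r1 r10 H1] := HG 1 ltr01.
(* Half of [e] pays for the remainder of [f], measured against an increment of size at most
   [(K + 1) * N h]; the other half pays for the remainder of [G] multiplied by [d]. Adding 1 keeps
   the denominators positive. *)
have e2 : 0 < e / 2 / (K + 1) by rewrite !divr_gt0.
have e3 : 0 < e / 2 / (cnorm d + 1) by rewrite !divr_gt0.
have [r2 r20 H2] := Hf _ e2.
have [r3 r30 H3] := HG _ e3.
exists (Num.min r1 (Num.min (r2 / (K + 1)) r3)).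
  by rewrite !lt_min r10 r30 divr_gt0.
move=> h; rewrite !lt_min => /and3P[hr1 hr2 hr3].
set k := G (t + h) - G t.
have kN : cnorm k <= (K + 1) * N h.
  have -> : k = (k - L h) + L h by rewrite subrK.
  rewrite (le_trans (cnormD _ _))// mulrDl addrC lerD//; exact: H1.
have k2 : cnorm k < r2.
  by rewrite (le_lt_trans kN)// mulrC -ltr_pdivlMr.
have Gk : G (t + h) = G t + k by rewrite /k; ring.
have -> : f (G (t + h)) - f (G t) - L h * d =
  (f (G t + k) - f (G t) - k * d) + (k - L h) * d.
  by rewrite Gk; ring.
rewrite (le_trans (cnormD _ _))// [e]splitr [leRHS]mulrDl lerD//.
  rewrite (le_trans (H2 _ k2))//.
  rewrite (le_trans (ler_wpM2l (ltW e2) kN))// mulrA divfK// gt_eqF//.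
rewrite cnormM (le_trans (ler_wpM2r (cnorm_ge0 _) (H3 _ hr3)))//.
rewrite mulrAC ler_wpM2r// mulrAC ler_pdivrMr// ler_wpM2l ?divr_ge0 ?ltW//; lra.
Qed.

Lemma has_cderiv_comp (f g : C -> C) (z d d' : C) :
  has_cderiv g z d -> has_cderiv f (g z) d' ->
  has_cderiv (f \o g) z (d * d').
Proof.
move=> Hg Hf e e0.
have LK (h : C) : cnorm (h * d) <= cnorm d * cnorm h by rewrite cnormM mulrC.
have [r r0 Hr] := @expand_chain C (@cnorm R) g (fun h => h * d) (cnorm d) f
   z d' (@cnorm_ge0 R) LK (cnorm_ge0 d) Hg Hf e e0.
by exists r => // h /Hr; rewrite mulrA.
Qed.

(** The velocity of a curve is stated by components, so that the real fundamental theorem and the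
    real mean value theorem apply to each of them. *)
Definition path_der (G : R -> C) t v :=
  is_derive t (1 : R) (fun s => cRe (G s)) (cRe v) /\
  is_derive t (1 : R) (fun s => cIm (G s)) (cIm v).

Lemma path_der_epsP G t v : path_der G t v <-> forall e : R, 0 < e ->
  exists2 r : R, 0 < r & forall h, `|h| < r ->
   cnorm (G (t + h) - G t - cplx_of_real h * v) <= e * `|h|.
Proof.
rewrite /path_der !is_derive_epsP; split=> [[H1 H2] e e0|H].
  have e2 : 0 < e / 2 by rewrite divr_gt0.
  have [r1 r10 Hr1] := H1 _ e2.
  have [r2 r20 Hr2] := H2 _ e2.
  exists (Num.min r1 r2); first by rewrite lt_min r10.
  move=> h; rewrite lt_min => /andP[/Hr1 h1 /Hr2 h2].
  rewrite (le_trans (cnorm_le _))// [e]splitr mulrDl.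
  rewrite !cReB !cImB cReM cImM cRe_real cIm_real !mul0r subr0 addr0.
  exact: lerD.
split=> e e0; have [r r0 Hr] := H e e0; exists r => // h /Hr; apply: le_trans.
  have := cRe_le (G (t + h) - G t - cplx_of_real h * v).
  by rewrite !cReB cReM cRe_real cIm_real mul0r subr0.
have := cIm_le (G (t + h) - G t - cplx_of_real h * v).
by rewrite !cImB cImM cRe_real cIm_real mul0r addr0.
Qed.

Lemma path_der_comp f G t v d : path_der G t v -> has_cderiv f (G t) d ->
  path_der (f \o G) t (v * d).
Proof.
move=> /path_der_epsP HG Hf; apply/path_der_epsP => e e0.
have LK (h : R) : cnorm (cplx_of_real h * v) <= cnorm v * `|h|.
  by rewrite cnormM cnorm_real mulrC.
have [r r0 Hr] := @expand_chain R (fun h => `|h|) G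
   (fun h => cplx_of_real h * v) (cnorm v) f t d (@normr_ge0 _ _) LK (cnorm_ge0 v)
   HG Hf e e0.
by exists r => // h /Hr; rewrite mulrA.
Qed.

Lemma path_derD F G t v w : path_der F t v -> path_der G t w ->
  path_der (fun s => F s + G s) t (v + w).
Proof.
move=> [F1 F2] [G1 G2]; split.
  under eq_fun do rewrite cReD.
  by rewrite cReD; exact: is_deriveD.
under eq_fun do rewrite cImD.
by rewrite cImD; exact: is_deriveD.
Qed.

Lemma path_derN F t v : path_der F t v -> path_der (fun s => - F s) t (- v).
Proof.
move=> [F1 F2]; split.
  under eq_fun do rewrite cReN.
  by rewrite cReN; exact: is_deriveN.
under eq_fun do rewrite cImN.
by rewrite cImN; exact: is_deriveN.
Qed.

Lemma path_derB F G t v w : path_der F t v -> path_der G t w ->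
  path_der (fun s => F s - G s) t (v - w).
Proof. by move=> HF HG; apply: path_derD => //; exact: path_derN. Qed.

Lemma path_derM F G t v w : path_der F t v -> path_der G t w ->
  path_der (fun s => F s * G s) t (v * G t + F t * w).
Proof.
move=> [F1 F2] [G1 G2]; split.
  under eq_fun do rewrite cReM.
  apply: (@is_derive_eq _ _ _ _ _ _ _ _ (is_deriveB (is_deriveM F1 G1) (is_deriveM F2
    G2))).
  rewrite /GRing.scale /= cReD !cReM; ring.
under eq_fun do rewrite cImM.
apply: (@is_derive_eq _ _ _ _ _ _ _ _ (is_deriveD (is_deriveM F1 G2) (is_deriveM F2 G1))).
rewrite /GRing.scale /= cImD !cImM; ring.
Qed.

Lemma path_der_conj F t v : path_der F t v -> path_der (fun s => (F s)^*) t v^*.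
Proof.
move=> [F1 F2]; split.
  under eq_fun do rewrite cRe_conj.
  by rewrite cRe_conj.
under eq_fun do rewrite cIm_conj.
by rewrite cIm_conj; exact: is_deriveN.
Qed.

Lemma path_der_cst c t : path_der (fun=> c) t 0.
Proof. by split; exact: is_derive_cst. Qed.

Lemma path_der_real t : path_der (@cplx_of_real R) t 1.
Proof. by split; [exact: is_derive_id|exact: is_derive_cst]. Qed.

Lemma path_der_eq F t v w : path_der F t v -> v = w -> path_der F t w.
Proof. by move=> + <-. Qed.

Lemma path_der_line a v t : path_der (fun s => a + cplx_of_real s * v) t v.
Proof.
apply: (path_der_eq (path_derD (path_der_cst a t) (path_derM (path_der_real t)
  (path_der_cst v t)))).
ring.
Qed.

Lemma path_derX F t v n : path_der F t v ->
  path_der (fun s => F s ^+ n) t (n%:R * F t ^+ n.-1 * v).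
Proof.
move=> HF; elim: n => [|n IH].
  by under eq_fun do rewrite expr0; rewrite !mul0r; exact: path_der_cst.
under eq_fun do rewrite exprS.
apply: path_der_eq (path_derM HF IH) _.
rewrite -pred_Sn -[n.+1%:R]natr1; case: n {IH} => [|n]; first by rewrite expr0; ring.
by rewrite -pred_Sn exprS; ring.
Qed.

Lemma path_der_continuous F t v : path_der F t v -> {for t, continuous F}.
Proof.
move=> [[F1 _] [F2 _]]; apply: cvgC.
  by apply: differentiable_continuous; apply/derivable1_diffP.
by apply: differentiable_continuous; apply/derivable1_diffP.
Qed.

End Chain.

(** * Integrals of complex-valued functions over a real interval *)

Section PathIntegral.
Variable R : realType.
Local Notation C := (Cplx R).
Local Notation mu := (@lebesgue_measure R).
Implicit Types (a b c : R) (F G : R -> C).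

Definition cint a b F : C := cintegral mu `[a, b] F.

Definition ccont a b F := {within `[a, b], continuous F}.

Lemma ccontP a b F : ccont a b F <->
  forall t, a <= t <= b -> F @ within `[a, b] (nbhs t) --> F t.
Proof.
rewrite /ccont; split.
  by move=> /subspace_continuousP H t tab; apply: H => /=; rewrite in_itv.
by move=> H; apply/subspace_continuousP => t /=; rewrite in_itv /=; exact: H.
Qed.

Lemma ccont_continuous a b F : (forall t, a <= t <= b -> {for t, continuous F}) ->
  ccont a b F.
Proof.
move=> H; apply/ccontP => t tab; apply: cvg_within_filter; exact: H.
Qed.

Lemma ccontD a b F G : ccont a b F -> ccont a b G -> ccont a b (fun t => F t + G t).
Proof.
move=> /ccontP HF /ccontP HG; apply/ccontP => t tab.
by apply: cvgD; [exact: HF|exact: HG].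
Qed.

Lemma ccontN a b F : ccont a b F -> ccont a b (fun t => - F t).
Proof.
by move=> /ccontP HF; apply/ccontP => t tab; apply: cvgN; exact: HF.
Qed.

Lemma ccontM a b F G : ccont a b F -> ccont a b G -> ccont a b (fun t => F t * G t).
Proof.
move=> /ccontP HF /ccontP HG; apply/ccontP => t tab.
by apply: cvgM; [exact: HF|exact: HG].
Qed.

Lemma ccont_cst a b (k : C) : ccont a b (fun=> k).
Proof. by apply/ccontP => t tab; exact: cvg_cst. Qed.

Lemma ccont_comp a b F (f : C -> C) : ccont a b F ->
  (forall t, a <= t <= b -> {for F t, continuous f}) -> ccont a b (f \o F).
Proof.
move=> /ccontP HF Hf; apply/ccontP => t tab.
by apply: cvg_comp (HF t tab) _; exact: Hf.
Qed.

Lemma ccont_Re a b F : ccont a b F -> {within `[a, b], continuous (fun t => cRe (F t))}.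
Proof.
move=> /ccontP HF; apply/subspace_continuousP => t /=; rewrite in_itv/= => tab.
by apply: cvg_cRe; exact: HF.
Qed.

Lemma ccont_Im a b F : ccont a b F -> {within `[a, b], continuous (fun t => cIm (F t))}.
Proof.
move=> /ccontP HF; apply/subspace_continuousP => t /=; rewrite in_itv/= => tab.
by apply: cvg_cIm; exact: HF.
Qed.

Lemma itv_integrable a b (f : R -> R) : {within `[a, b], continuous f} ->
  mu.-integrable `[a, b] (EFin \o f).
Proof. by apply: continuous_compact_integrable; exact: segment_compact. Qed.

Lemma eq_cint a b F G : (forall t, a <= t <= b -> F t = G t) ->
  cint a b F = cint a b G.
Proof.
move=> FG; congr Complex; apply: eq_Rintegral => t; rewrite inE /= in_itv/= => tab;
  by rewrite FG.
Qed.

Lemma cintD a b F G : ccont a b F -> ccont a b G ->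
  cint a b (fun t => F t + G t) = cint a b F + cint a b G.
Proof.
move=> cF cG.
have := itv_integrable (ccont_Re cF); have := itv_integrable (ccont_Im cF).
have := itv_integrable (ccont_Re cG); have := itv_integrable (ccont_Im cG).
move=> GI GR FI FR; apply: cplxP; rewrite /cint /cintegral.
  rewrite cReD /= -RintegralD//.
  by apply: eq_Rintegral => t _; rewrite /= cReD.
rewrite cImD /= -RintegralD//.
by apply: eq_Rintegral => t _; rewrite /= cImD.
Qed.

Lemma cintZ a b (k : C) F : ccont a b F ->
  cint a b (fun t => k * F t) = k * cint a b F.
Proof.
move=> cF; have FR := itv_integrable (ccont_Re cF);
  have FI := itv_integrable (ccont_Im cF).
have kR r : mu.-integrable `[a, b] (EFin \o (fun t => r * cRe (F t))).
  by apply: itv_integrable => t; apply: cvgM; [exact: cvg_cst|exact: (ccont_Re cF)].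
have kI r : mu.-integrable `[a, b] (EFin \o (fun t => r * cIm (F t))).
  by apply: itv_integrable => t; apply: cvgM; [exact: cvg_cst|exact: (ccont_Im cF)].
apply: cplxP; rewrite /cint /cintegral.
  rewrite cReM /= -!RintegralZl// -RintegralB//.
  by apply: eq_Rintegral => t _; rewrite /= cReM.
rewrite cImM /= -!RintegralZl// -RintegralD//.
by apply: eq_Rintegral => t _; rewrite /= cImM.
Qed.

Lemma cintN a b F : ccont a b F -> cint a b (fun t => - F t) = - cint a b F.
Proof.
by move=> cF; rewrite -mulN1r -cintZ//; apply: eq_cint => t _; rewrite mulN1r.
Qed.

Lemma cintB a b F G : ccont a b F -> ccont a b G ->
  cint a b (fun t => F t - G t) = cint a b F - cint a b G.
Proof. by move=> cF cG; rewrite (cintD cF (ccontN cG)) (cintN cG). Qed.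

Lemma Rint_le a b (f : R -> R) (M : R) : a <= b ->
  {within `[a, b], continuous f} ->
  (forall t, a <= t <= b -> `|f t| <= M) ->
  `|Rintegral mu `[a, b] f| <= M * (b - a).
Proof.
move=> ab cf fM.
have fi := itv_integrable cf.
apply: le_trans (le_normr_Rintegral _ fi) _ => //.
have -> : M * (b - a) = Rintegral mu `[a, b] (fun=> M).
  rewrite Rintegral_cst//= lebesgue_measure_itv /= lte_fin.
  by move: ab; rewrite le_eqVlt => /predU1P[->|->//]; rewrite ltxx subrr.
apply: le_Rintegral => //.
  exact: integrable_norm.
by apply: itv_integrable => t; exact: cvg_cst.
Qed.

(** The factor 2 is the price of bounding the real and imaginary parts separately. Later arguments
    only need some constant. *)
Lemma cint_le a b F (M : R) : a <= b -> ccont a b F ->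
  (forall t, a <= t <= b -> cnorm (F t) <= M) ->
  cnorm (cint a b F) <= M * (b - a) *+ 2.
Proof.
move=> ab cF FM; rewrite (le_trans (cnorm_le _))// mulr2n lerD//.
  apply: Rint_le (ccont_Re cF) _ => // t tab.
  by rewrite (le_trans (cRe_le _))// FM.
apply: Rint_le (ccont_Im cF) _ => // t tab.
by rewrite (le_trans (cIm_le _))// FM.
Qed.

Lemma Rint_split a b c (f : R -> R) : a <= c <= b -> {within `[a, b], continuous f} ->
  Rintegral mu `[a, b] f = Rintegral mu `[a, c] f + Rintegral mu `[c, b] f.
Proof.
move=> /andP[ac cb] cf; have fi := itv_integrable cf.
have H := @Rintegral_itvB R f (BLeft a) (BRight b) c fi.
have {H} := H ac cb.
rewrite Rintegral_itv_obnd_cbnd; last first.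
  apply: integrableS fi => // x /=; rewrite !in_itv/= => /andP[cx ->].
  by rewrite (le_trans ac)// ltW.
by move=> <-; rewrite addrC subrK.
Qed.

Lemma cint_split a b c F : a <= c <= b -> ccont a b F ->
  cint a b F = cint a c F + cint c b F.
Proof.
move=> acb cF; apply: cplxP; rewrite ?cReD ?cImD /=; apply: Rint_split => //.
  exact: ccont_Re.
exact: ccont_Im.
Qed.

Lemma Rint_FTC a b (f g : R -> R) : a <= b -> {within `[a, b], continuous f} ->
  (forall t, a <= t <= b -> is_derive t (1 : R) g (f t)) ->
  Rintegral mu `[a, b] f = g b - g a.
Proof.
move=> + cf df; rewrite le_eqVlt => /predU1P[ab|ab].
  by rewrite -ab set_itv1 Rintegral_set1 subrr.
rewrite /Rintegral (@continuous_FTC2 _ f g a b ab cf)//.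
  have cg t : a <= t <= b -> {for t, continuous g}.
    by move=> /df[dg _]; apply: differentiable_continuous; apply/derivable1_diffP.
  split.
  - by move=> t; rewrite in_itv/= => /andP[/ltW a1 /ltW a2]; case: (df t); rewrite ?a1.
  - by apply: cvg_at_right_filter; apply: cg; rewrite lexx ltW.
  - by apply: cvg_at_left_filter; apply: cg; rewrite lexx ltW.
move=> t; rewrite in_itv/= => /andP[/ltW a1 /ltW a2].
by rewrite derive1E; case: (df t); rewrite ?a1.
Qed.

Lemma cint_FTC a b F G : a <= b -> ccont a b F ->
  (forall t, a <= t <= b -> path_der G t (F t)) -> cint a b F = G b - G a.
Proof.
move=> ab cF dG; apply: cplxP; rewrite ?cReB ?cImB /=.
  by apply: (@Rint_FTC _ _ _ (fun t => cRe (G t)) ab (ccont_Re cF)) => t /dG[].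
by apply: (@Rint_FTC _ _ _ (fun t => cIm (G t)) ab (ccont_Im cF)) => t /dG[].
Qed.

Lemma cint_cst a b (k : C) : a <= b -> cint a b (fun=> k) = cplx_of_real (b - a) * k.
Proof.
move=> ab; rewrite (@cint_FTC _ _ _ (fun t => 0 + cplx_of_real t * k)) //.
- by rewrite cplxB !add0r mulrBl.
- exact: ccont_cst.
- by move=> t _; exact: path_der_line.
Qed.

End PathIntegral.

(** * Goursat's lemma *)

Section Bisection.
Variable R : realType.

(** Left ends increase and right ends decrease, so the supremum of the left ends lies in every
    interval. *)
Lemma nested_point (l : R) (x : nat -> R) : 0 <= l ->
  (forall n, x n <= x n.+1) ->
  (forall n, x n.+1 + l / 2 ^+ n.+1 <= x n + l / 2 ^+ n) ->
  exists y, forall n, x n <= y <= x n + l / 2 ^+ n.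
Proof.
move=> l0 xi xd.
have mono n k : x n <= x (n + k)%N.
  by elim: k => [|k IH]; rewrite ?addn0// addnS (le_trans IH).
have anti n k : x (n + k)%N + l / 2 ^+ (n + k) <= x n + l / 2 ^+ n.
  by elim: k => [|k IH]; rewrite ?addn0// addnS (le_trans _ IH).
have pos n : 0 <= l / 2 ^+ n by rewrite divr_ge0// exprn_ge0.
have ub n m : x m <= x n + l / 2 ^+ n.
  have := mono m n; have := anti n m; rewrite [(m + n)%N]addnC => h1 h2.
  by have := pos (n + m)%N; lra.
have hs : has_sup (range x).
  split; first by exists (x 0%N); exists 0%N.
  by exists (x 0%N + l / 2 ^+ 0) => _ [m _ <-]; exact: ub.
exists (sup (range x)) => n; apply/andP; split.
  by apply: ub_le_sup; [case: hs|exists n].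
by apply: ge_sup; [case: hs|move=> _ [m _ <-]; exact: ub].
Qed.

Lemma ex_small_half (l r : R) : 0 <= l -> 0 < r -> exists n, l / 2 ^+ n < r.
Proof.
move=> l0 r0; exists (Num.bound (l / r)).
rewrite ltr_pdivrMr ?exprn_gt0// mulrC -ltr_pdivrMr//.
have lr0 : 0 <= l / r by rewrite divr_ge0// ltW.
rewrite (lt_trans (archi_boundP lr0))// -natrX ltr_nat.
exact: ltn_expl.
Qed.

Lemma half_step (a b p q l : R) : 0 <= l -> a <= p -> p + (l + l) <= b ->
  q = p \/ q = p + l ->
  [/\ a <= q, q + l <= b, p <= q & q + l <= p + (l + l)].
Proof. by move=> l0 ap pb [->|->]; split; lra. Qed.

Variable J : R -> R -> R -> R -> Cplx R.

(** The bisection argument for an abstract rectangle function: [J] is additive under quartering and,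
    near each point, negligible against the square of the half-perimeter. If [J] were nonzero, some
    quarter would keep at least a fourth of its norm at each stage. The selected rectangles shrink
    to a point, and there the decay by 4 per stage, exactly that of the squared half-perimeter,
    contradicts the local bound. *)
Lemma rectangle_bisection (a b c d : R) : a <= b -> c <= d ->
  (forall a' b' c' d', a <= a' -> a' <= b' -> b' <= b ->
     c <= c' -> c' <= d' -> d' <= d ->
     let m := (a' + b') / 2 in let n := (c' + d') / 2 in
     J a' b' c' d' = J a' m c' n + J m b' c' n + (J a' m n d' + J m b' n d')) ->
  (forall x y, a <= x <= b -> c <= y <= d -> forall e : R, 0 < e ->
     exists2 r : R, 0 < r & forall a' b' c' d',
       a <= a' -> b' <= b -> a' <= x <= b' ->
       c <= c' -> d' <= d -> c' <= y <= d' -> b' - a' < r -> d' - c' < r ->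
       cnorm (J a' b' c' d') <= e * ((b' - a') + (d' - c')) ^+ 2) ->
  J a b c d = 0.
Proof.
move=> ab cd Jadd Jloc; apply/eqP; rewrite -cnorm_eq0 eq_le cnorm_ge0 andbT leNgt.
apply/negP => J0; set eta := cnorm _ in J0.
set l := b - a; set k := d - c.
have l0 : 0 <= l by rewrite subr_ge0.
have k0 : 0 <= k by rewrite subr_ge0.
have p20 n : 0 < 2 ^+ n :> R by rewrite exprn_gt0.
(* A rectangle of stage [n] is recorded by its lower left corner alone; its sides are [l / 2 ^+ n]
   and [k / 2 ^+ n]. *)
pose Q n (p : R * R) := J p.1 (p.1 + l / 2 ^+ n) p.2 (p.2 + k / 2 ^+ n).
pose good n (p : R * R) := [/\ a <= p.1, p.1 + l / 2 ^+ n <= b, c <= p.2,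
  p.2 + k / 2 ^+ n <= d & eta / 4 ^+ n <= cnorm (Q n p)].
pose sub n (p q : R * R) := [/\ p.1 <= q.1, q.1 + l / 2 ^+ n.+1 <= p.1 + l / 2 ^+ n,
  p.2 <= q.2 & q.2 + k / 2 ^+ n.+1 <= p.2 + k / 2 ^+ n].
have step n p : good n p -> exists q, good n.+1 q /\ sub n p q.
  case=> p1 p2 p3 p4 p5.
  have l' : l / 2 ^+ n = l / 2 ^+ n.+1 + l / 2 ^+ n.+1.
    by rewrite exprS; field; rewrite gt_eqF.
  have k' : k / 2 ^+ n = k / 2 ^+ n.+1 + k / 2 ^+ n.+1.
    by rewrite exprS; field; rewrite gt_eqF.
  have e4 : eta / 4 ^+ n = (eta / 4 ^+ n.+1) * 4.
    by rewrite exprS; field; rewrite gt_eqF// exprn_gt0.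
  set l1 := l / 2 ^+ n.+1 in l' *; set k1 := k / 2 ^+ n.+1 in k' *.
  have l10 : 0 <= l1 by rewrite divr_ge0// ltW.
  have k10 : 0 <= k1 by rewrite divr_ge0// ltW.
  have m1 : (p.1 + (p.1 + l / 2 ^+ n)) / 2 = p.1 + l1 by rewrite l'; lra.
  have n1 : (p.2 + (p.2 + k / 2 ^+ n)) / 2 = p.2 + k1 by rewrite k'; lra.
  have := Jadd p.1 (p.1 + l / 2 ^+ n) p.2 (p.2 + k / 2 ^+ n).
  rewrite /= m1 n1 => JE.
  have {JE} : Q n p = Q n.+1 p + Q n.+1 (p.1 + l1, p.2)
     + (Q n.+1 (p.1, p.2 + k1) + Q n.+1 (p.1 + l1, p.2 + k1)).
    rewrite /Q /= -/l1 -/k1 JE ?l' ?k' ?addrA//; lra.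
  move=> QE.
  (* If all four quarters were below [eta / 4 ^+ n.+1], the triangle inequality would put the parent
     below [eta / 4 ^+ n]. *)
  have : exists q, [/\ q.1 = p.1 \/ q.1 = p.1 + l1, q.2 = p.2 \/ q.2 = p.2 + k1
     & eta / 4 ^+ n.+1 <= cnorm (Q n.+1 q)].
    apply: contrapT => /forallNP H.
    have lt q : q.1 = p.1 \/ q.1 = p.1 + l1 -> q.2 = p.2 \/ q.2 = p.2 + k1 ->
        cnorm (Q n.+1 q) < eta / 4 ^+ n.+1.
      by move=> h1 h2; rewrite ltNge; apply/negP => h3; apply: (H q).
    have h1 := lt p (or_introl erefl) (or_introl erefl).
    have h2 := lt (p.1 + l1, p.2) (or_intror erefl) (or_introl erefl).
    have h3 := lt (p.1, p.2 + k1) (or_introl erefl) (or_intror erefl).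
    have h4 := lt (p.1 + l1, p.2 + k1) (or_intror erefl) (or_intror erefl).
    have := cnormD (Q n.+1 p + Q n.+1 (p.1 + l1, p.2))
      (Q n.+1 (p.1, p.2 + k1) + Q n.+1 (p.1 + l1, p.2 + k1)).
    rewrite -QE.
    have := cnormD (Q n.+1 p) (Q n.+1 (p.1 + l1, p.2)).
    have := cnormD (Q n.+1 (p.1, p.2 + k1)) (Q n.+1 (p.1 + l1, p.2 + k1)).
    move: p5; rewrite e4; lra.
  case=> q [q1 q2 q3]; exists q.
  rewrite l' in p2; rewrite k' in p4.
  have [h1 h2 h3 h4] := half_step l10 p1 p2 q1.
  have [h5 h6 h7 h8] := half_step k10 p3 p4 q2.
  by split; split; rewrite -/l1 -/k1 ?l' ?k'.
(* The default [P m] is never resorted to, because [step] supplies a suitable quarter at each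
   stage. *)
pose P := fix P n : R * R := if n is m.+1
  then xget (P m) [set q | good m.+1 q /\ sub m (P m) q] else (a, c).
have Pgood n : good n (P n).
  elim: n => [|n /step[q qP]].
    by split; rewrite /= /Q /= ?expr0 ?divr1 /l /k ?[a + _]addrC ?[c + _]addrC
      ?subrK// /eta.
  by have [] : [set q | good n.+1 q /\ sub n (P n) q] (P n.+1);
    first by apply: xgetPex; exists q.
have Psub n : sub n (P n) (P n.+1).
  have [q qP] := step _ _ (Pgood n).
  by have [] : [set q | good n.+1 q /\ sub n (P n) q] (P n.+1);
    first by apply: xgetPex; exists q.
have [x xP] : exists x, forall n, (P n).1 <= x <= (P n).1 + l / 2 ^+ n.
  by apply: nested_point => // n; case: (Psub n).
have [y yP] : exists y, forall n, (P n).2 <= y <= (P n).2 + k / 2 ^+ n.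
  by apply: nested_point => // n; case: (Psub n).
have xab : a <= x <= b.
  by have := xP 0%N; rewrite /= expr0 divr1 /l addrC subrK.
have ycd : c <= y <= d.
  by have := yP 0%N; rewrite /= expr0 divr1 /k addrC subrK.
have s1 : 0 < (l + k) ^+ 2 + 1 by rewrite ltr_wpDl// sqr_ge0.
(* This epsilon times [(l + k) ^+ 2] is strictly below [eta], also for a rectangle reduced to a
   point, thanks to the added 1. *)
have e0 : 0 < eta / 2 / ((l + k) ^+ 2 + 1) by rewrite !divr_gt0.
have [r r0 Hr] := Jloc x y xab ycd _ e0.
have [n nr] := ex_small_half (addr_ge0 l0 k0) r0.
have ln : 0 <= l / 2 ^+ n by rewrite divr_ge0// ltW.
have kn : 0 <= k / 2 ^+ n by rewrite divr_ge0// ltW.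
have [g1 g2 g3 g4 g5] := Pgood n.
have := Hr (P n).1 ((P n).1 + l / 2 ^+ n) (P n).2 ((P n).2 + k / 2 ^+ n)
  g1 g2 (xP n) g3 g4 (yP n).
rewrite ![_ + _ / _ - _]addrAC !subrr !add0r.
have h1 : l / 2 ^+ n < r by move: nr; rewrite mulrDl; lra.
have h2 : k / 2 ^+ n < r by move: nr; rewrite mulrDl; lra.
move=> /(_ h1 h2); apply/negP; rewrite -ltNge (lt_le_trans _ g5)//.
have -> : 4 ^+ n = (2 ^+ n) ^+ 2 :> R by rewrite exprAC; congr (_ ^+ n); ring.
rewrite -mulrDl exprMn exprVn mulrA ltr_pM2r ?invr_gt0 ?exprn_gt0//.
rewrite mulrAC ltr_pdivrMr// mulrDr mulr1.
have := sqr_ge0 (l + k); nra.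
Qed.

End Bisection.

(** * Integrals over the boundary of a rectangle *)

Section Goursat.
Variable R : realType.
Local Notation C := (Cplx R).

Definition ci : C := Complex 0 1.

Lemma cnorm_ci : cnorm ci = 1.
Proof. by rewrite cnormE /= expr0n expr1n add0r sqrtr1. Qed.

Lemma mul_ci_inj (z w : C) : ci * (z - w) = 0 -> z = w.
Proof.
move=> /eqP; rewrite mulf_eq0 -cnorm_eq0 cnorm_ci oner_eq0 /= subr_eq0.
by move=> /eqP.
Qed.

Lemma path_der_hline (c x : R) : path_der (fun t => Complex t c : C) x 1.
Proof. by split; [exact: is_derive_id|exact: is_derive_cst]. Qed.

Lemma path_der_vline (a y : R) : path_der (fun t => Complex a t : C) y ci.
Proof. by split; [exact: is_derive_cst|exact: is_derive_id]. Qed.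

(** The integral of [F(z) dz] around the boundary of [[a, b] x [c, d]], counterclockwise; [ci] is
    [dz/dy] on the vertical sides. *)
Definition rect_int (F : C -> C) (a b c d : R) : C :=
  cint a b (fun x => F (Complex x c)) - cint a b (fun x => F (Complex x d)) +
  ci * (cint c d (fun y => F (Complex b y)) - cint c d (fun y => F (Complex a y))).

Definition rect_cont (F : C -> C) (a b c d : R) :=
  forall x y, a <= x <= b -> c <= y <= d -> {for (Complex x y : C), continuous F}.

Lemma rect_cont_h F a b c d y : rect_cont F a b c d -> c <= y <= d ->
  ccont a b (fun x => F (Complex x y)).
Proof.
move=> HF ycd; apply: (@ccont_comp _ _ _ (fun x => Complex x y : C)).
  by apply: ccont_continuous => t _; exact: path_der_continuous (path_der_hline y t).
by move=> t tab; exact: HF.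
Qed.

Lemma rect_cont_v F a b c d x : rect_cont F a b c d -> a <= x <= b ->
  ccont c d (fun y => F (Complex x y)).
Proof.
move=> HF xab; apply: (@ccont_comp _ _ _ (fun y => Complex x y : C)).
  by apply: ccont_continuous => t _; exact: path_der_continuous (path_der_vline x t).
by move=> t tcd; exact: HF.
Qed.

Lemma rect_contW F a b c d a' b' c' d' : rect_cont F a b c d ->
  a <= a' -> b' <= b -> c <= c' -> d' <= d -> rect_cont F a' b' c' d'.
Proof.
move=> HF aa bb cc dd x y /andP[x1 x2] /andP[y1 y2]; apply: HF.
  by rewrite (le_trans aa)// (le_trans x2).
by rewrite (le_trans cc)// (le_trans y2).
Qed.

Lemma rect_intD F G a b c d : a <= b -> c <= d ->
  rect_cont F a b c d -> rect_cont G a b c d ->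
  rect_int (fun z => F z + G z) a b c d = rect_int F a b c d + rect_int G a b c d.
Proof.
move=> ab cd HF HG.
have la : a <= a <= b by rewrite lexx.
have lb : a <= b <= b by rewrite lexx ab.
have lc : c <= c <= d by rewrite lexx.
have ld : c <= d <= d by rewrite lexx cd.
rewrite /rect_int (cintD (rect_cont_h HF lc) (rect_cont_h HG lc)).
rewrite (cintD (rect_cont_h HF ld) (rect_cont_h HG ld)).
rewrite (cintD (rect_cont_v HF la) (rect_cont_v HG la)).
rewrite (cintD (rect_cont_v HF lb) (rect_cont_v HG lb)).
ring.
Qed.

Lemma rect_int_add F a b c d m n : rect_cont F a b c d ->
  a <= m <= b -> c <= n <= d ->
  rect_int F a b c d = rect_int F a m c n + rect_int F m b c n
    + (rect_int F a m n d + rect_int F m b n d).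
Proof.
move=> HF mab ncd; have /andP[am mb] := mab; have /andP[cn nd] := ncd.
rewrite /rect_int.
rewrite (@cint_split _ a b m (fun x => F (Complex x c)))//; last first.
  by apply: (rect_cont_h HF); rewrite lexx (le_trans cn).
rewrite (@cint_split _ a b m (fun x => F (Complex x d)))//; last first.
  by apply: (rect_cont_h HF); rewrite lexx (le_trans cn).
rewrite (@cint_split _ c d n (fun y => F (Complex a y)))//; last first.
  by apply: (rect_cont_v HF); rewrite lexx (le_trans am).
rewrite (@cint_split _ c d n (fun y => F (Complex b y)))//; last first.
  by apply: (rect_cont_v HF); rewrite lexx (le_trans am).
ring.
Qed.

(** Each side contributes the difference of [P] at its two ends, and around the boundary the corner
    values cancel. It serves to discard the affine part of a function in [Goursat]. *)
Lemma rect_int_primitive F P a b c d : a <= b -> c <= d ->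
  rect_cont F a b c d ->
  (forall w, has_cderiv P w (F w)) -> rect_int F a b c d = 0.
Proof.
move=> ab cd HF HP; rewrite /rect_int.
have Hh y : c <= y <= d -> cint a b (fun x => F (Complex x y)) =
    P (Complex b y) - P (Complex a y).
  move=> ycd; apply: (@cint_FTC _ _ _ _ (fun x => P (Complex x y))) => //.
    exact: rect_cont_h HF ycd.
  by move=> t _; apply: path_der_eq (path_der_comp (path_der_hline y t) (HP _)) _;
    rewrite mul1r.
have Hv x : a <= x <= b -> ci * cint c d (fun y => F (Complex x y)) =
    P (Complex x d) - P (Complex x c).
  move=> xab; rewrite -cintZ; last exact: rect_cont_v HF xab.
  apply: (@cint_FTC _ _ _ _ (fun y => P (Complex x y))) => //.
    by apply: ccontM; [exact: ccont_cst|exact: rect_cont_v HF xab].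
  by move=> t _; exact: path_der_comp (path_der_vline x t) (HP _).
by rewrite mulrBr (Hh c) ?(Hh d) ?(Hv a) ?(Hv b) ?lexx ?ab ?cd//; ring.
Qed.

Lemma rect_int_le F a b c d (M : R) : a <= b -> c <= d -> rect_cont F a b c d ->
  (forall x y, a <= x <= b -> c <= y <= d -> cnorm (F (Complex x y)) <= M) ->
  cnorm (rect_int F a b c d) <= 4 * (M * ((b - a) + (d - c))).
Proof.
move=> ab cd HF FM.
have Hh y : c <= y <= d -> cnorm (cint a b (fun x =>
  F (Complex x y))) <= M * (b - a) *+ 2.
  move=> ycd; apply: cint_le => //; first exact: rect_cont_h HF ycd.
  by move=> t tab; exact: FM.
have Hv x : a <= x <= b -> cnorm (cint c d (fun y =>
  F (Complex x y))) <= M * (d - c) *+ 2.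
  move=> xab; apply: cint_le => //; first exact: rect_cont_v HF xab.
  by move=> t tcd; exact: FM.
have h1 := Hh c; have h2 := Hh d; have h3 := Hv a; have h4 := Hv b.
rewrite !lexx ab cd in h1 h2 h3 h4.
rewrite (le_trans (cnormD _ _))// cnormM cnorm_ci mul1r.
have := cnormB (cint a b (fun x => F (Complex x c))) (cint a b (fun x =>
  F (Complex x d))).
have := cnormB (cint c d (fun y => F (Complex b y))) (cint c d (fun y =>
  F (Complex a y))).
move: (h1 isT) (h2 isT) (h3 isT) (h4 isT); rewrite !mulr2n !mulrDr; lra.
Qed.

Lemma has_cderivD f g (z d d' : C) : has_cderiv f z d -> has_cderiv g z d' ->
  has_cderiv (fun w => f w + g w) z (d + d').
Proof. by move=> /has_cderivP Hf /has_cderivP Hg; apply/has_cderivP;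
  exact: is_deriveD. Qed.

Lemma has_cderivB f g (z d d' : C) : has_cderiv f z d -> has_cderiv g z d' ->
  has_cderiv (fun w => f w - g w) z (d - d').
Proof. by move=> /has_cderivP Hf /has_cderivP Hg; apply/has_cderivP;
  exact: is_deriveB. Qed.

Lemma has_cderivM f g (z d d' : C) : has_cderiv f z d -> has_cderiv g z d' ->
  has_cderiv (fun w => f w * g w) z (d * g z + f z * d').
Proof.
move=> /has_cderivP Hf /has_cderivP Hg; apply/has_cderivP.
apply: is_derive_eq (is_deriveM Hf Hg) _.
by rewrite /GRing.scale /=; ring.
Qed.

Lemma has_cderiv_cst (k z : C) : has_cderiv (fun=> k) z 0.
Proof. by apply/has_cderivP; exact: is_derive_cst. Qed.

Lemma has_cderiv_id (z : C) : has_cderiv id z 1.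
Proof. by apply/has_cderivP; exact: is_derive_id. Qed.

Lemma has_cderiv_eq f (z d d' : C) : has_cderiv f z d -> d = d' -> has_cderiv f z d'.
Proof. by move=> + <-. Qed.

(** Near a point [p] the function is an affine part, whose boundary integral is zero, plus a
    remainder of size [o(s)] on rectangles of half-perimeter [s]. The boundary has length [2 s], so
    the integral is [o(s^2)], which is the local condition of [rectangle_bisection].
    Differentiability at each point is all that enters. *)
Theorem Goursat F a b c d : a <= b -> c <= d ->
  (forall x y, a <= x <= b -> c <= y <= d ->
     exists k, has_cderiv F (Complex x y) k) ->
  rect_int F a b c d = 0.
Proof.
move=> ab cd dF.
have cF : rect_cont F a b c d.
  by move=> x y xab ycd; have [k /has_cderiv_continuous] := dF x y xab ycd.
apply: (@rectangle_bisection _ (rect_int F)) => //.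
  move=> a' b' c' d' a1 a2 a3 c1 c2 c3 /=.
  by apply: rect_int_add; [exact: rect_contW cF _ _ _ _| |]; apply/andP; split; lra.
move=> x y xab ycd e e0.
have [k Fk] := dF x y xab ycd; set p : C := Complex x y in Fk.
(* The division by 4 cancels the constant of [rect_int_le]. *)
have e4 : 0 < e / 4 by rewrite divr_gt0.
have [r r0 Hr] := Fk _ e4.
(* Sides shorter than [r / 2] have sum below [r], so the whole rectangle lies within distance [r] of
   [p]. *)
exists (r / 2); first by rewrite divr_gt0.
move=> a' b' c' d' aa bb /andP[ax xb] cc dd /andP[cy yd] rb rd.
have ab' := le_trans ax xb; have cd' := le_trans cy yd.
pose aff (w : C) := F p + (w - p) * k.
have daff w : has_cderiv aff w k.
  apply: has_cderiv_eq (has_cderivD (has_cderiv_cst (F p) w) (has_cderivM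
    (has_cderivB (has_cderiv_id w) (has_cderiv_cst p w)) (has_cderiv_cst k w))) _.
  by ring.
pose rem w := F w - aff w.
have crem : rect_cont rem a' b' c' d'.
  move=> u v uab vcd.
  exact: continuousB (rect_contW cF aa bb cc dd uab vcd) (has_cderiv_continuous (daff _)).
have caff : rect_cont aff a' b' c' d'.
  by move=> u v uab vcd; exact: has_cderiv_continuous (daff _).
have -> : rect_int F a' b' c' d' = rect_int rem a' b' c' d'.
  have FE : F = (fun z => rem z + aff z) by apply/funext => w; rewrite /rem subrK.
  rewrite [in LHS]FE.
  (* A primitive of the affine part is [F p * w + (w - p)^2 * k / 2]. *)
  rewrite rect_intD// (@rect_int_primitive aff
    (fun w => F p * w + (w - p) * (w - p) * (k / 2)) a' b')// ?addr0// => w.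
  have dwp : has_cderiv (fun u => u - p) w 1.
    by apply: has_cderiv_eq (has_cderivB (has_cderiv_id w) (has_cderiv_cst p w)) _; ring.
  apply: has_cderiv_eq (has_cderivD (has_cderivM (has_cderiv_cst (F p) w)
    (has_cderiv_id w)) (has_cderivM (has_cderivM dwp dwp) (has_cderiv_cst (k / 2) w))) _.
  by rewrite /aff; field.
set s := (b' - a') + (d' - c').
have s0 : 0 <= s by rewrite /s; lra.
have -> : e * s ^+ 2 = 4 * (e / 4 * s * s) by field.
apply: rect_int_le => // u v /andP[u1 u2] /andP[v1 v2].
set w : C := Complex u v.
have ws : cnorm (w - p) <= s.
  rewrite (le_trans (cnorm_le _))// cReB cImB /= lerD// ler_norml; lra.
have wr : cnorm (w - p) < r by rewrite (le_lt_trans ws)// /s; lra.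
have := Hr _ wr; rewrite [p + _]addrC subrK => H.
have -> : rem w = F w - F p - (w - p) * k by rewrite /rem /aff; ring.
by rewrite (le_trans H)// ler_wpM2l// ltW.
Qed.

End Goursat.

(** * The derivative as an integral over a circle *)

Section Holomorphic.
Variable R : realType.
Local Notation C := (Cplx R).
Local Notation ci := (ci R).

(** * The complex exponential *)

Definition cis (y : R) : C := Complex (cos y) (sin y).
Definition cexp (w : C) : C := cplx_of_real (expR (cRe w)) * cis (cIm w).

Lemma cisD x y : cis (x + y) = cis x * cis y.
Proof. by apply: cplxP; rewrite ?cReM ?cImM /= ?cosD ?sinD//; ring. Qed.

Lemma cis0 : cis 0 = 1.
Proof. by rewrite /cis cos0 sin0. Qed.

Lemma cis2pi : cis (pi *+ 2) = 1.
Proof. by rewrite /cis cos2pi sin2pi. Qed.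

Lemma cexpD w h : cexp (w + h) = cexp w * cexp h.
Proof. by rewrite /cexp cReD cImD expRD cisD cplxM; ring. Qed.

Lemma cexp0 : cexp 0 = 1.
Proof. by rewrite /cexp /= expR0 cis0 mulr1. Qed.

Lemma cexpN w : cexp w * cexp (- w) = 1.
Proof. by rewrite -cexpD subrr cexp0. Qed.

Lemma cnorm_cis y : cnorm (cis y) = 1.
Proof. by rewrite cnormE /= cos2Dsin2 sqrtr1. Qed.

Lemma cnorm_cexp w : cnorm (cexp w) = expR (cRe w).
Proof. by rewrite cnormM cnorm_cis mulr1 cnorm_real ger0_norm// expR_ge0. Qed.

Lemma path_der_cis y : path_der cis y (ci * cis y).
Proof.
split; rewrite ?cReM ?cImM /= ?mul0r ?sub0r ?mul1r ?add0r.
  exact: is_derive_cos.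
exact: is_derive_sin.
Qed.

(** With [a = e^(Re h)] and [b = e^(i Im h)], the remainder [a b - 1 - h] splits into the remainders
    of the two real-variable curves and the product [(a - 1) (b - 1)], which is quadratic in [h]. *)
Lemma has_cderiv_cexp0 : has_cderiv cexp 0 1.
Proof.
have dE : path_der (fun s => cplx_of_real (expR s)) (0 : R) 1.
  by split; rewrite /=; [have := is_derive_expR (0 : R);
    rewrite expR0|exact: is_derive_cst].
have dC := path_der_cis 0; rewrite cis0 mulr1 in dC.
move=> e e0.
have e3 : 0 < e / 3 by rewrite divr_gt0.
have [r1 r10 H1] := (path_der_epsP _ _ _).1 dE _ e3.
have [r2 r20 H2] := (path_der_epsP _ _ _).1 dC _ e3.
have [r3 r30 H3] := (path_der_epsP _ _ _).1 dE _ ltr01.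
have [r4 r40 H4] := (path_der_epsP _ _ _).1 dC _ ltr01.
(* The radii [r3] and [r4] give [|a - 1|, |b - 1| <= 2 |h|], so the product is at most [4 |h|^2];
   below [e / 12] this is at most [e / 3 * |h|], the last third of the error. *)
exists (Num.min (Num.min r1 r2) (Num.min (Num.min r3 r4) (e / 12))).
  by rewrite !lt_min r10 r20 r30 r40 divr_gt0.
move=> h; rewrite !lt_min => /andP[/andP[h1 h2] /andP[/andP[h3 h4] h5]].
have aR := cRe_le h; have aI := cIm_le h.
have := H1 _ (le_lt_trans aR h1); have := H3 _ (le_lt_trans aR h3).
have := H2 _ (le_lt_trans aI h2); have := H4 _ (le_lt_trans aI h4).
rewrite !add0r expR0 cplx1 cis0 cexp0.
set a := cplx_of_real (expR (cRe h)); set b := cis (cIm h).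
set x := cplx_of_real (cRe h); set y := cplx_of_real (cIm h).
have hE : h = x + y * ci.
  by apply: cplxP; rewrite ?cReD ?cImD ?cReM ?cImM /=; ring.
move=> K4 K2 K3 K1.
have b1 : cnorm (b - 1) <= 2 * cnorm h.
  have -> : b - 1 = (b - 1 - y * ci) + y * ci by rewrite subrK.
  rewrite (le_trans (cnormD _ _))// cnormM cnorm_real cnorm_ci.
  lra.
have a1 : cnorm (a - 1) <= 2 * cnorm h.
  have -> : a - 1 = (a - 1 - x * 1) + x * 1 by rewrite subrK.
  rewrite (le_trans (cnormD _ _))// cnormM cnorm_real cnorm1.
  lra.
have -> : cexp h - 1 - h * 1 = (a - 1 - x * 1) + (b - 1 - y * ci) + (a - 1) * (b - 1).
  by rewrite {2}hE /cexp -/a -/b; ring.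
have := cnormD (a - 1 - x * 1 + (b - 1 - y * ci)) ((a - 1) * (b - 1)).
have := cnormD (a - 1 - x * 1) (b - 1 - y * ci).
rewrite cnormM.
have := cnorm_ge0 (a - 1); have := cnorm_ge0 (b - 1); have := cnorm_ge0 h.
move=> n0 nb na t1 t2.
have := ler_pM na nb a1 b1.
have : e / 3 * `|cRe h| <= e / 3 * cnorm h by rewrite ler_wpM2l// ltW.
have : e / 3 * `|cIm h| <= e / 3 * cnorm h by rewrite ler_wpM2l// ltW.
have : cnorm h * cnorm h <= e / 12 * cnorm h by rewrite ler_wpM2r// ltW.
nra.
Qed.

(** The functional equation carries the expansion at 0 to [w], scaled by the nonzero factor
    [cexp w]. *)
Lemma has_cderiv_cexp w : has_cderiv cexp w (cexp w).
Proof.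
move=> e e0; have c0 : 0 < cnorm (cexp w) by rewrite cnorm_cexp expR_gt0.
have [r r0 Hr] := has_cderiv_cexp0 (divr_gt0 e0 c0).
exists r => // h /Hr; rewrite add0r cexp0 mulr1 cexpD.
have -> : cexp w * cexp h - cexp w - h * cexp w = cexp w * (cexp h - 1 - h) by ring.
rewrite cnormM => H.
have := ler_wpM2l (ltW c0) H; rewrite mulrA [_ * (_ / _)]mulrC divfK// gt_eqF//.
Qed.

Lemma has_cderivN f (z d : C) : has_cderiv f z d -> has_cderiv (fun w => - f w) z (- d).
Proof. by move=> /has_cderivP Hf; apply/has_cderivP; exact: is_deriveN. Qed.

(** * Holomorphic functions on the unit disk and their circle integrals *)

Definition hol (f : C -> C) := forall z, cnorm z < 1 -> has_cderiv f z (derive1 f z).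

Lemma hol_continuous f z : hol f -> cnorm z < 1 -> {for z, continuous f}.
Proof. by move=> hf /hf; exact: has_cderiv_continuous. Qed.

Lemma ccont_cis a b : ccont a b cis.
Proof. by apply: ccont_continuous => t _;
  exact: path_der_continuous (path_der_cis t). Qed.

Lemma ccont_pder a b F (dF : R -> C) : (forall t, a <= t <= b -> path_der F t (dF t))
  -> ccont a b F.
Proof. by move=> H; apply: ccont_continuous => t /H; exact: path_der_continuous. Qed.

Lemma cexpC (s y : R) : cexp (Complex s y) = cplx_of_real (expR s) * cis y.
Proof. by []. Qed.

(** In the variable [zeta = z + e^w] this says that the integral of [f(zeta) (zeta - z)^(-2) d zeta]
    over a circle around [z] does not depend on the radius. The logarithmic coordinate turns the
    annulus into a rectangle, where [Goursat] applies, and the two horizontal sides are the same cut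
    traversed in opposite directions. *)
Lemma rect_hol_int (f : C -> C) (z : C) (s0 s1 : R) : hol f ->
  cnorm z + expR s1 < 1 -> s0 <= s1 ->
  let V s := cint 0 (pi *+ 2) (fun y =>
    f (z + cexp (Complex s y)) * cexp (- (Complex s y : C))) in
  V s0 = V s1.
Proof.
move=> hf zs s01 V.
have pi2 : 0 <= pi *+ 2 :> R by rewrite mulrn_wge0// pi_ge0.
pose F (w : C) := f (z + cexp w) * cexp (- w).
have H0 : rect_int F s0 s1 0 (pi *+ 2) = 0.
  apply: Goursat => // x y /andP[_ xs] _; eexists.
  apply: has_cderivM.
    apply: (@has_cderiv_comp _ f).
      exact: has_cderivD (has_cderiv_cst z _) (has_cderiv_cexp _).
    apply: hf; rewrite (le_lt_trans (cnormD _ _))// (le_lt_trans _ zs)// lerD2l.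
    by rewrite cnorm_cexp /= ler_expR.
  apply: (@has_cderiv_comp _ cexp) (has_cderiv_cexp _).
  exact: has_cderivN (has_cderiv_id _).
have hor : cint s0 s1 (fun x => F (Complex x 0)) = cint s0 s1 (fun x =>
  F (Complex x (pi *+ 2))).
  apply: eq_cint => x _; rewrite /F.
  have N0 : - (Complex x 0 : C) = Complex (- x) 0 by apply: cplxP;
    rewrite ?cReN ?cImN//= oppr0.
  have cisN : cis (- (pi *+ 2)) = 1.
    by have := cisD (pi *+ 2) (- (pi *+ 2)); rewrite subrr cis2pi cis0 mul1r.
  have N1 : - (Complex x (pi *+ 2) : C) = Complex (- x) (- (pi *+ 2)) by [].
  by rewrite N0 N1 !cexpC cis0 cis2pi cisN.
move: H0; rewrite /rect_int hor subrr add0r => H0.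
exact: esym (mul_ci_inj H0).
Qed.

Lemma derive_circle (f : C -> C) (z : C) (r : R) : hol f -> 0 < r -> cnorm z + r < 1 ->
  cplx_of_real (pi *+ 2) * derive1 f z =
  cint 0 (pi *+ 2) (fun y => cis (- y) / cplx_of_real r * f (z + cplx_of_real r * cis y)).
Proof.
move=> hf r0 zr.
have pi2 : 0 <= pi *+ 2 :> R by rewrite mulrn_wge0// pi_ge0.
pose V s := cint 0 (pi *+ 2) (fun y =>
    f (z + cexp (Complex s y)) * cexp (- (Complex s y : C))).
have zs : cnorm z + expR (ln r) < 1 by rewrite lnK// posrE.
have Vc s : s <= ln r -> V s = V (ln r) by move=> sr; exact: (rect_hol_int hf zs sr).
have z1 : cnorm z < 1 by lra.
have dN s y : path_der (fun t => - (Complex s t : C)) y (- ci) by exact: path_derN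
  (path_der_vline s y).
have dcexpN s y : path_der (fun t => cexp (- (Complex s t : C))) y (- ci * cexp (-
  (Complex s y : C))).
  exact: path_der_comp (dN s y) (has_cderiv_cexp _).
have ccN s : ccont 0 (pi *+ 2) (fun y => cexp (- (Complex s y : C))).
  by apply: ccont_pder => t _; exact: dcexpN.
(* Along the vertical line [ci * e^(-w)] is a primitive of [e^(-w)], with equal values at the two
   ends of a period. *)
have intN s : cint 0 (pi *+ 2) (fun y => cexp (- (Complex s y : C))) = 0.
  rewrite (@cint_FTC _ _ _ _ (fun y => ci * cexp (- (Complex s y : C))))//.
    have N1 y : - (Complex s y : C) = Complex (- s) (- y) by [].
    have cisN : cis (- (pi *+ 2)) = 1.
      by have := cisD (pi *+ 2) (- (pi *+ 2)); rewrite subrr cis2pi cis0 mul1r.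
    by rewrite !N1 !cexpC cisN oppr0 cis0 subrr.
  move=> t _; apply: path_der_eq (path_derM (path_der_cst _ _) (dcexpN s t)) _.
  rewrite mul0r add0r mulrA.
  have -> : ci * - ci = 1 by apply: cplxP; rewrite ?cReM ?cImM ?cReN ?cImN /=; ring.
  by rewrite mul1r.
have ccf s : s <= ln r -> ccont 0 (pi *+ 2) (fun y => f (z + cexp (Complex s y))).
  move=> sr; apply: (@ccont_comp _ _ _ (fun y => z + cexp (Complex s y))).
    apply: ccontD; first exact: ccont_cst.
    apply: ccont_pder => t _.
    exact: path_der_comp (path_der_vline s t) (has_cderiv_cexp _).
  move=> t _; apply: hol_continuous => //.
  rewrite (le_lt_trans (cnormD _ _))// (le_lt_trans _ zs)// lerD2l.
  by rewrite cnorm_cexp /= ler_expR.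
(* As s -> -oo, e^(-w) (f (z + e^w) - f z) -> f' z uniformly on Re w = s,
   while f z * e^(-w) has integral 0 over a period. *)
have Vlim : V (ln r) = cplx_of_real (pi *+ 2) * derive1 f z.
  apply/eqP; rewrite -subr_eq0 -cnorm_eq0 eq_le cnorm_ge0 andbT.
  apply/ler_addgt0Pl => e e0; rewrite addr0.
  (* The interval has length [2 pi] and [cint_le] doubles it; the product stays below this
     denominator. *)
  have p4 : 0 < pi *+ 2 * 2 + 1 :> R by lra.
  have [r' r'0 Hr'] := hf z z1 _ (divr_gt0 e0 p4).
  (* Left of [ln r] the function [V] is constant, and [e^s < r'] brings the circle into the range of
     the expansion of [f] at [z]. *)
  set s := Num.min (ln r) (ln (r' / 2)).
  have sr : s <= ln r by rewrite ge_min lexx.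
  have sr' : expR s < r'.
    rewrite (@le_lt_trans _ _ (r' / 2))//; last by lra.
    rewrite -[leRHS]lnK ?posrE ?divr_gt0// ler_expR.
    by rewrite ge_min lexx orbT.
  rewrite -(Vc s sr).
  have -> : V s - cplx_of_real (pi *+ 2) * derive1 f z =
     cint 0 (pi *+ 2) (fun y => f (z + cexp (Complex s y)) * cexp (- (Complex s y : C))
        - derive1 f z - f z * cexp (- (Complex s y : C))).
    rewrite cintB; last 2 first.
    - apply: ccontD; last exact: ccont_cst.
      by apply: ccontM; [exact: ccf|exact: ccN].
    - by apply: ccontM; [exact: ccont_cst|exact: ccN].
    rewrite cintZ// intN mulr0 subr0 cintB; last 2 first.
    - by apply: ccontM; [exact: ccf|exact: ccN].
    - exact: ccont_cst.
    by rewrite cint_cst// subr0.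
  apply: le_trans (cint_le (M := e / (pi *+ 2 * 2 + 1)) pi2 _ _) _.
  - apply: ccontD; last by apply: ccontN; apply: ccontM; [exact: ccont_cst|exact: ccN].
    apply: ccontD; last exact: ccont_cst.
    by apply: ccontM; [exact: ccf|exact: ccN].
  - move=> t _; set w : C := Complex s t.
    have cw := cexpN w.
    have nw : cnorm (cexp w) = expR s by rewrite cnorm_cexp.
    have -> : f (z + cexp w) * cexp (- w) - derive1 f z - f z * cexp (- w) =
      (f (z + cexp w) - f z - cexp w * derive1 f z) * cexp (- w).
      transitivity (f (z + cexp w) * cexp (- w) - (cexp w * cexp (- w)) * derive1 f z
         - f z * cexp (- w)); first by rewrite cw mul1r.
      ring.
    rewrite cnormM -ler_pdivlMr; last by rewrite cnorm_cexp expR_gt0.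
    have -> : (cnorm (cexp (- w)))^-1 = cnorm (cexp w).
      by rewrite !cnorm_cexp cReN expRN invrK.
    by apply: Hr'; rewrite nw.
  rewrite subr0 -mulr_natr -mulrA mulrAC ler_pdivrMr// ler_wpM2l ?ltW//; lra.
rewrite -Vlim; apply: eq_cint => t _.
rewrite cexpC lnK ?posrE// mulrC; congr (_ * _).
have -> : - (Complex (ln r) t : C) = Complex (- ln r) (- t) by [].
by rewrite cexpC expRN lnK ?posrE// mulrC; congr (_ * _);
  exact: (fmorphV (real_complex R)).
Qed.

(** The mean value points of the real and imaginary parts differ, so they are taken separately; this
    costs the factor 2. *)
Lemma mvt_path (G : R -> C) (dG : R -> C) (M : R) :
  (forall t, 0 <= t <= 1 -> path_der G t (dG t)) ->
  (forall t, 0 <= t <= 1 -> cnorm (dG t) <= M) -> cnorm (G 1 - G 0) <= 2 * M.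
Proof.
move=> HG HM.
have cG : ccont 0 1 G by exact: ccont_pder HG.
have in01 (t : R) : t \in `]0, 1[ -> 0 <= t <= 1 :> bool.
  by rewrite in_itv/= => /andP[/ltW -> /ltW ->].
have in01' (t : R) : t \in `[0, 1] -> 0 <= t <= 1 :> bool by rewrite in_itv.
have [x1 hx1 E1] := MVT_segment ler01 (fun x hx => (HG x (in01 x hx)).1) (ccont_Re cG).
have [x2 hx2 E2] := MVT_segment ler01 (fun x hx => (HG x (in01 x hx)).2) (ccont_Im cG).
rewrite (le_trans (cnorm_le _))// cReB cImB E1 E2 subr0 !mulr1.
have := HM _ (in01' _ hx1); have := HM _ (in01' _ hx2).
have := cRe_le (dG x1); have := cIm_le (dG x2); lra.
Qed.

Lemma segment_disk (w v : C) (rho t : R) : 0 <= t <= 1 -> cnorm w <= rho -> cnorm v <=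
  rho ->
  cnorm (w + cplx_of_real t * (v - w)) <= rho.
Proof.
move=> /andP[t0 t1] wr vr.
have -> : w + cplx_of_real t * (v - w) = cplx_of_real (1 - t) * w + cplx_of_real t * v.
  by rewrite cplxB cplx1; ring.
rewrite (le_trans (cnormD _ _))// !cnormM !cnorm_real !ger0_norm ?subr_ge0//; nra.
Qed.

(** The closed disk is viewed in [R * R] as a closed subset of a product of two segments, hence
    compact. *)
Lemma cont_bounded (f : C -> C) (rho : R) :
  (forall z, cnorm z <= rho -> {for z, continuous f}) ->
  exists2 M : R, 0 <= M & forall z, cnorm z <= rho -> cnorm (f z) <= M.
Proof.
move=> cf.
pose K : set (R * R) := [set p | cnorm (Complex p.1 p.2 : C) <= rho].
have cc (p : R * R) : (fun q : R * R => Complex q.1 q.2 : C) @ nbhs p --> (Complex p.1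
  p.2 : C).
  by apply: cvgC => /=; [exact: cvg_fst|exact: cvg_snd].
have cK : compact K.
  apply: (@subclosed_compact _ _ (`[- rho, rho] `*` `[- rho, rho])).
  - have -> : K = (fun p : R * R => cnorm (Complex p.1 p.2 : C)) @^-1` [set x | x <=
    rho] by [].
    apply: closed_comp; last exact: closed_le.
    move=> p _; apply: cvg_cRe; apply: cvg_norm; exact: cc.
  - by apply: compact_setX; exact: segment_compact.
  - move=> [x y] /= Kxy; split => /=; rewrite in_itv/= -ler_norml.
      exact: le_trans (cRe_le (Complex x y : C)) Kxy.
    exact: le_trans (cIm_le (Complex x y : C)) Kxy.
have cg : {within K, continuous (fun p : R * R => cnorm (f (Complex p.1 p.2)))}.
  apply/subspace_continuousP => p Kp; apply: cvg_cRe; apply: cvg_norm.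
  apply: cvg_within_filter.
  exact: (@cvg_comp _ _ _ _ f _ _ _ (cc p) (cf _ Kp)).
have /compact_bounded[M [_ HM]] := continuous_compact cg cK.
exists (`|M| + 1); first by rewrite addr_ge0.
move=> z zr; have := HM (`|M| + 1); rewrite (le_lt_trans (ler_norm M)) ?ltrDl// =>
  /(_ isT).
have Kz : K (cRe z, cIm z) by rewrite /K /=; case: z zr.
move=> H; have {}H := H (cnorm (f z)); rewrite /= ger0_norm ?cnorm_ge0// in H.
by apply: H; exists (cRe z, cIm z) => //=; case: z {zr Kz}.
Qed.

End Holomorphic.

(** * Holomorphic functions are infinitely differentiable *)

Section Regularity.
Variable R : realType.
Local Notation C := (Cplx R).
Local Notation ci := (ci R).

Lemma has_cderiv_local (f g : C -> C) (z d : C) (r : R) : 0 < r ->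
  (forall w, cnorm (w - z) < r -> f w = g w) -> has_cderiv f z d -> has_cderiv g z d.
Proof.
move=> r0 fg Hf e e0; have [r' r'0 Hr'] := Hf e e0.
exists (Num.min r r'); first by rewrite lt_min r0.
move=> h; rewrite lt_min => /andP[h1 h2]; rewrite -!fg; first exact: Hr'.
  by rewrite subrr cnorm0.
by rewrite addrC addKr.
Qed.

Lemma hol_bounded (f : C -> C) (rho : R) : hol f -> rho < 1 ->
  exists2 M : R, 0 <= M & forall z, cnorm z <= rho -> cnorm (f z) <= M.
Proof.
move=> hf r1; apply: cont_bounded => z zr; apply: hol_continuous => //.
exact: le_lt_trans zr r1.
Qed.

Lemma ccont_cisN (a b : R) : ccont a b (fun y => cis (- y)).
Proof.
have -> : (fun y : R => cis (- y)) = (fun y => (cis y)^*).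
  by apply/funext => y; rewrite /cis cosN sinN.
by apply: (@ccont_pder _ _ _ _ (fun y => (ci * cis y)^*)) => t _;
  exact/path_der_conj/path_der_cis.
Qed.

Lemma circle_cont (f : C -> C) (z : C) (r : R) : hol f -> 0 < r -> cnorm z + r < 1 ->
  ccont 0 (pi *+ 2) (fun y => cis (- y) / cplx_of_real r * f (z + cplx_of_real r * cis
    y)).
Proof.
move=> hf r0 zr.
apply: ccontM; first by apply: ccontM; [exact: ccont_cisN|exact: ccont_cst].
apply: (@ccont_comp _ _ _ (fun y => z + cplx_of_real r * cis y)).
  apply: ccontD; first exact: ccont_cst.
  by apply: ccontM; [exact: ccont_cst|exact: ccont_cis].
move=> t _; apply: hol_continuous => //.
by rewrite (le_lt_trans (cnormD _ _))// cnormM cnorm_cis mulr1 cnorm_real gtr0_norm.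
Qed.

(** Cauchy's estimate for the derivative, with the factor 2 inherited from [cint_le]. *)
Lemma circle_le (f : C -> C) (z : C) (r M : R) : hol f -> 0 < r -> cnorm z + r < 1 ->
  (forall w, cnorm w <= cnorm z + r -> cnorm (f w) <= M) ->
  cnorm (derive1 f z) <= 2 * M / r.
Proof.
move=> hf r0 zr fM.
have p0 : 0 < pi :> R := pi_gt0 R.
have pi2 : 0 < pi *+ 2 :> R by rewrite pmulrn_lgt0.
have H : cnorm (cplx_of_real (pi *+ 2) * derive1 f z) <= M / r * (pi *+ 2 - 0) *+ 2.
  rewrite (derive_circle hf r0 zr); apply: cint_le; first exact: ltW.
    exact: circle_cont.
  move=> t _; rewrite !cnormM cnorm_cis mul1r cnormV cnorm_real gtr0_norm//.
  rewrite mulrC ler_pM2r ?invr_gt0//; apply: fM.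
  by rewrite (le_trans (cnormD _ _))// cnormM cnorm_cis mulr1 cnorm_real gtr0_norm.
move: H; rewrite cnormM cnorm_real gtr0_norm// subr0 mulrC -mulrnAl ler_pM2r//.
by rewrite -mulr_natl mulrA.
Qed.

Lemma derive_bounded (f : C -> C) (rho : R) : hol f -> rho < 1 ->
  exists2 M : R, 0 <= M & forall z, cnorm z <= rho -> cnorm (derive1 f z) <= M.
Proof.
move=> hf r1; set r := (1 - rho) / 2; have r0 : 0 < r by rewrite /r; lra.
have rr : rho + r < 1 by rewrite /r; lra.
have [M M0 HM] := hol_bounded hf rr.
exists (2 * M / r); first by apply: divr_ge0; [exact: mulr_ge0|exact: ltW].
move=> z zr; apply: circle_le => //; first lra.
by move=> w wr; apply: HM; lra.
Qed.

Lemma hol_lipschitz (f : C -> C) (rho : R) : hol f -> rho < 1 ->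
  exists2 L : R, 0 <= L & forall w v, cnorm w <= rho -> cnorm v <= rho ->
    cnorm (f v - f w) <= L * cnorm (v - w).
Proof.
move=> hf r1; have [M M0 HM] := derive_bounded hf r1.
exists (2 * M); first by rewrite mulr_ge0.
move=> w v wr vr.
have := @mvt_path _ (fun t => f (w + cplx_of_real t * (v - w)))
  (fun t => (v - w) * derive1 f (w + cplx_of_real t * (v - w))) (M * cnorm (v - w)).
rewrite cplx0 cplx1 mul0r mul1r addr0 [w + _]addrC subrK mulrA; apply => t t01.
  apply: (@path_der_comp _ f (fun t => w + cplx_of_real t * (v - w)) t _ _
    (path_der_line _ _ _)).
  by apply: hf; rewrite (le_lt_trans (segment_disk t01 wr vr)).
rewrite cnormM mulrC ler_wpM2r ?cnorm_ge0//; apply: HM; exact: segment_disk.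
Qed.

(** Writing both derivatives as circle integrals of the same radius [r], their difference involves
    only values of [f] at points differing by [v - w]. The derivative thus inherits the Lipschitz
    bound of [f] on the disk of radius [rho + r]. *)
Lemma derive_lipschitz (f : C -> C) (rho : R) : hol f -> rho < 1 ->
  exists2 L : R, 0 <= L & forall w v, cnorm w <= rho -> cnorm v <= rho ->
    cnorm (derive1 f v - derive1 f w) <= L * cnorm (v - w).
Proof.
move=> hf r1; set r := (1 - rho) / 2; have r0 : 0 < r by rewrite /r; lra.
have rr : rho + r < 1 by rewrite /r; lra.
have [L L0 HL] := hol_lipschitz hf rr.
have p0 : 0 < pi :> R := pi_gt0 R.
have pi2 : 0 < pi *+ 2 :> R by rewrite pmulrn_lgt0.
exists (2 * L / r); first by apply: divr_ge0; [exact: mulr_ge0|exact: ltW].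
move=> w v wr vr.
have wr' : cnorm w + r < 1 by lra.
have vr' : cnorm v + r < 1 by lra.
have H : cnorm (cplx_of_real (pi *+ 2) * (derive1 f v - derive1 f w)) <=
    L * cnorm (v - w) / r * (pi *+ 2 - 0) *+ 2.
  rewrite mulrBr [X in X - _](derive_circle hf r0 vr').
  rewrite [X in _ - X](derive_circle hf r0 wr').
  rewrite -[X in cnorm X](cintB (circle_cont hf r0 vr') (circle_cont hf r0 wr')).
  apply: cint_le; first exact: ltW.
    apply: ccontD; first exact: circle_cont.
    by apply: ccontN; exact: circle_cont.
  move=> t _; rewrite -mulrBr !cnormM cnorm_cis mul1r cnormV cnorm_real gtr0_norm//.
  rewrite mulrC ler_pM2r ?invr_gt0//.
  have cr : cnorm (cplx_of_real r * cis t) = r.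
    by rewrite cnormM cnorm_cis mulr1 cnorm_real gtr0_norm.
  have := HL (w + cplx_of_real r * cis t) (v + cplx_of_real r * cis t).
  have -> : v + cplx_of_real r * cis t - (w + cplx_of_real r * cis t) = v - w by ring.
  apply; rewrite (le_trans (cnormD _ _))// cr lerD2r//.
move: H; rewrite cnormM cnorm_real gtr0_norm// subr0 mulrC -mulrnAl ler_pM2r//.
by rewrite -mulr_natl !mulrA => /le_trans; apply; rewrite mulrAC.
Qed.

(** A Lipschitz derivative already gives a quadratic remainder: [mvt_path] is applied on the segment
    to [f] minus its linear part at [w]. The constant is uniform in [w], which is what
    differentiation under the integral sign uses. *)
Lemma taylor1 (f : C -> C) (rho : R) : hol f -> rho < 1 ->
  exists2 L : R, 0 <= L & forall w v, cnorm w <= rho -> cnorm v <= rho ->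
    cnorm (f v - f w - (v - w) * derive1 f w) <= L * cnorm (v - w) ^+ 2.
Proof.
move=> hf r1; have [L L0 HL] := derive_lipschitz hf r1.
exists (2 * L); first by rewrite mulr_ge0.
move=> w v wr vr.
have := @mvt_path _
  (fun t => f (w + cplx_of_real t * (v - w)) - (0 + cplx_of_real t * ((v - w) * derive1
    f w)))
  (fun t => (v - w) * derive1 f (w + cplx_of_real t * (v - w)) - (v - w) * derive1 f w)
  (L * cnorm (v - w) ^+ 2).
rewrite cplx0 cplx1 !mul0r !mul1r !addr0 !add0r [w + _]addrC subrK subr0 mulrA.
have -> : f v - f w - (v - w) * derive1 f w = f v - (v - w) * derive1 f w - f w by ring.
apply => t t01.
  apply: path_derB; last exact: path_der_line.
  apply: (@path_der_comp _ f (fun t => w + cplx_of_real t * (v - w)) t _ _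
    (path_der_line _ _ _)).
  by apply: hf; rewrite (le_lt_trans (segment_disk t01 wr vr)).
rewrite -mulrBr cnormM expr2 mulrA mulrC ler_wpM2r ?cnorm_ge0//.
have wt := segment_disk t01 wr vr.
rewrite (le_trans (HL _ _ wr wt))// addrC addKr cnormM cnorm_real.
rewrite ler_wpM2l// ger0_norm; last by case/andP: t01.
by rewrite ler_piMl ?cnorm_ge0//; case/andP: t01.
Qed.

Lemma derive_cont (f : C -> C) z : hol f -> cnorm z < 1 -> {for z, continuous (derive1
  f)}.
Proof.
move=> hf z1; apply/continuousCP => e e0.
set rho := (1 + cnorm z) / 2; have r1 : rho < 1 by rewrite /rho; lra.
have [L L0 HL] := derive_lipschitz hf r1.
exists (Num.min (rho - cnorm z) (e / (L + 1))).
  rewrite lt_min; apply/andP; split; first by rewrite /rho; lra.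
  by rewrite divr_gt0// ltr_wpDl.
move=> w; rewrite lt_min => /andP[w1 w2].
have wr : cnorm w <= rho.
  have := cnormD (w - z) z; rewrite subrK; lra.
have zr : cnorm z <= rho by rewrite /rho; lra.
have := HL _ _ zr wr; move: w2; rewrite ltr_pdivlMr ?ltr_wpDl//.
have := cnorm_ge0 (w - z); nra.
Qed.

(** The affine argument [al t + be t * z] covers both applications: circle integrals, with [be]
    equal to 1, and radial integrals, with [al] equal to 0 and [be t] equal to [t]. The remainder of
    [taylor1] is quadratic uniformly in [t], so it stays quadratic in the increment after
    integration. *)
Lemma derive_under_cint (a b : R) (k al be : R -> C) (f : C -> C) (z0 : C)
    (rho del Kk Kb : R) :
  a <= b -> ccont a b k -> ccont a b al -> ccont a b be -> hol f ->
  rho < 1 -> 0 < del ->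
  (forall t w, a <= t <= b -> cnorm (w - z0) < del -> cnorm (al t + be t * w) <= rho) ->
  (forall t, a <= t <= b -> cnorm (k t) <= Kk) ->
  (forall t, a <= t <= b -> cnorm (be t) <= Kb) ->
  has_cderiv (fun z => cint a b (fun t => k t * f (al t + be t * z))) z0
    (cint a b (fun t => k t * be t * derive1 f (al t + be t * z0))).
Proof.
move=> ab ck cal cbe hf r1 d0 Hrho HKk HKb e e0.
have [L L0 HL] := taylor1 hf r1.
have Kk0 : 0 <= Kk by rewrite (le_trans (cnorm_ge0 _) (HKk a _))// lexx.
have Kb0 : 0 <= Kb by rewrite (le_trans (cnorm_ge0 _) (HKb a _))// lexx.
have z00 : cnorm (z0 - z0) < del by rewrite subrr cnorm0.
have cl w : ccont a b (fun t => al t + be t * w) := ccontD cal (ccontM cbe (@ccont_cst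
  R a b w)).
have cf w : cnorm (w - z0) < del -> ccont a b (fun t => k t * f (al t + be t * w)).
  move=> wd; apply: (ccontM ck); apply: (ccont_comp (cl w)).
  by move=> t tab; apply: hol_continuous => //; rewrite (le_lt_trans (Hrho t w tab wd)).
have cdf : ccont a b (fun t => k t * be t * derive1 f (al t + be t * z0)).
  apply: (ccontM (ccontM ck cbe)); apply: (ccont_comp (cl z0)).
  by move=> t tab; apply: derive_cont => //; rewrite (le_lt_trans (Hrho t z0 tab z00)).
(* The coefficient of [|h|^2] in the integrated remainder, doubled by [cint_le]. *)
set B := Kk * L * Kb ^+ 2 * (b - a) *+ 2.
have B0 : 0 <= B by rewrite mulrn_wge0// !mulr_ge0// ?sqr_ge0// subr_ge0.
exists (Num.min del (e / (B + 1))).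
  by rewrite lt_min d0 divr_gt0// ltr_wpDl.
move=> h; rewrite lt_min => /andP[h1 h2].
have zh : cnorm (z0 + h - z0) < del by rewrite addrC addKr.
have cdfh : ccont a b (fun t => h * (k t * be t * derive1 f (al t + be t * z0))).
  exact: ccontM (@ccont_cst R a b h) cdf.
have cdif := ccontD (cf _ zh) (ccontN (cf _ z00)).
have -> : cint a b (fun t => k t * f (al t + be t * (z0 + h))) -
    cint a b (fun t => k t * f (al t + be t * z0)) -
    h * cint a b (fun t => k t * be t * derive1 f (al t + be t * z0)) =
    cint a b (fun t => k t * f (al t + be t * (z0 + h)) - k t * f (al t + be t * z0)
      - h * (k t * be t * derive1 f (al t + be t * z0))).
  by rewrite (cintB cdif cdfh) (cintB (cf _ zh) (cf _ z00)) (cintZ h cdf).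
apply: (@le_trans _ _ (B * cnorm h ^+ 2)).
  have -> : B * cnorm h ^+ 2 = Kk * L * Kb ^+ 2 * cnorm h ^+ 2 * (b - a) *+ 2.
    by rewrite /B mulrnAl; congr (_ *+ _); ring.
  apply: (cint_le ab); first exact: ccontD cdif (ccontN cdfh).
  move=> t tab.
  have -> : k t * f (al t + be t * (z0 + h)) - k t * f (al t + be t * z0)
    - h * (k t * be t * derive1 f (al t + be t * z0)) = k t *
    (f (al t + be t * (z0 + h)) - f (al t + be t * z0)
     - (al t + be t * (z0 + h) - (al t + be t * z0)) * derive1 f (al t + be t * z0)).
    by ring.
  rewrite cnormM -!mulrA ler_pM ?cnorm_ge0 ?HKk//.
  rewrite (le_trans (HL _ _ (Hrho t _ tab z00) (Hrho t _ tab zh)))// ler_wpM2l//.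
  have -> : al t + be t * (z0 + h) - (al t + be t * z0) = be t * h by ring.
  rewrite cnormM exprMn [leRHS]mulrA -[Kb * Kb]expr2 ler_wpM2r ?sqr_ge0// ler_sqr
    ?nnegrE ?cnorm_ge0//.
  exact: HKb.
rewrite expr2 mulrA ler_wpM2r ?cnorm_ge0//.
move: h2; rewrite ltr_pdivlMr ?ltr_wpDl//.
have := cnorm_ge0 h; nra.
Qed.

(** Near [z] the derivative is a circle integral of one fixed radius whose integrand depends on the
    centre only through [f], so it can be differentiated under the integral sign. *)
Theorem hol_derive (f : C -> C) : hol f -> hol (derive1 f).
Proof.
(* With a quarter of the distance to the unit circle, all circles of radius [r] centred within [r]
   of [z] stay in the disk of radius [cnorm z + 2 * r], which is less than 1. *)
move=> hf z z1; set r := (1 - cnorm z) / 4.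
have r0 : 0 < r by rewrite /r; lra.
suff [d Hd] : exists d, has_cderiv (derive1 f) z d.
  by have [_ ->] := has_cderiv_derivable Hd.
have p0 : 0 < pi :> R := pi_gt0 R.
have pi2 : 0 < pi *+ 2 :> R by rewrite pmulrn_lgt0.
pose g w := cint 0 (pi *+ 2) (fun y => cis (- y) / cplx_of_real r * f (cplx_of_real r *
  cis y + 1 * w)).
have cr t : cnorm (cplx_of_real r * cis t) = r.
  by rewrite cnormM cnorm_cis mulr1 cnorm_real gtr0_norm.
have [d Hd] : exists d, has_cderiv g z d.
  eexists; apply: (@derive_under_cint 0 (pi *+ 2) (fun y => cis (- y) / cplx_of_real r)
    (fun y => cplx_of_real r * cis y) (fun=> 1) f z (cnorm z + 2 * r) r (1 / r) 1) => //.
  - exact: ltW.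
  - by apply: ccontM; [exact: ccont_cisN|exact: ccont_cst].
  - by apply: ccontM; [exact: ccont_cst|exact: ccont_cis].
  - exact: ccont_cst.
  - by rewrite /r; lra.
  - move=> t w _ wz; rewrite mul1r (le_trans (cnormD _ _))// cr.
    by have := cnormD (w - z) z; rewrite subrK; lra.
  - by move=> t _; rewrite cnormM cnorm_cis cnormV cnorm_real gtr0_norm.
  - by move=> t _; rewrite cnorm1.
exists ((cplx_of_real (pi *+ 2))^-1 * d).
have Hg : has_cderiv (fun w => (cplx_of_real (pi *+ 2))^-1 * g w) z
    ((cplx_of_real (pi *+ 2))^-1 * d).
  apply: has_cderiv_eq (has_cderivM (has_cderiv_cst _ z) Hd) _.
  by rewrite mul0r add0r.
apply: (has_cderiv_local r0 _ Hg) => w wz.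
have wr : cnorm w + r < 1.
  by have := cnormD (w - z) z; rewrite subrK /r; rewrite /r in wz; lra.
have gE : g w = cplx_of_real (pi *+ 2) * derive1 f w.
  rewrite (derive_circle hf r0 wr); apply: eq_cint => t _.
  by rewrite mul1r addrC.
rewrite gE mulrA mulVf ?mul1r//.
by rewrite -cnorm_eq0 cnorm_real gtr0_norm// gt_eqF.
Qed.

End Regularity.

(** * Division by powers of z and radial integrals *)

Section Division.
Variable R : realType.
Local Notation C := (Cplx R).

Lemma has_hol (f f' : C -> C) : (forall z, cnorm z < 1 -> has_cderiv f z (f' z)) -> hol f.
Proof. by move=> H z z1; have [_ ->] := has_cderiv_derivable (H z z1); exact: H. Qed.

Lemma has_cderiv_disk (f g : C -> C) z d : (forall w, cnorm w < 1 -> f w = g w) ->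
  cnorm z < 1 -> has_cderiv f z d -> has_cderiv g z d.
Proof.
move=> fg z1; apply: (@has_cderiv_local _ f g z d (1 - cnorm z)); first by lra.
by move=> w wz; apply: fg; have := cnormD (w - z) z; rewrite subrK; lra.
Qed.

Lemma hol_ext (f g : C -> C) : (forall w, cnorm w < 1 -> f w = g w) -> hol f ->
  hol g /\ (forall z, cnorm z < 1 -> derive1 f z = derive1 g z).
Proof.
move=> fg hf; have H z : cnorm z < 1 -> has_cderiv g z (derive1 f z).
  by move=> z1; apply: (has_cderiv_disk fg z1); exact: hf.
split; first exact: has_hol H.
by move=> z /H /has_cderiv_derivable[_ ->].
Qed.

Lemma holM (f g : C -> C) : hol f -> hol g -> hol (fun z => f z * g z).
Proof. by move=> hf hg; apply: has_hol => z z1;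
  exact: has_cderivM (hf z z1) (hg z z1). Qed.

Lemma holB (f g : C -> C) : hol f -> hol g -> hol (fun z => f z - g z).
Proof. by move=> hf hg; apply: has_hol => z z1;
  exact: has_cderivB (hf z z1) (hg z z1). Qed.

Lemma hol_cst (k : C) : hol (fun=> k).
Proof. by apply: has_hol => z z1; exact: has_cderiv_cst. Qed.

Lemma has_cderivX (z : C) n : has_cderiv (fun w => w ^+ n) z (n%:R * z ^+ n.-1).
Proof.
elim: n => [|n IH].
  by under eq_fun do rewrite expr0; rewrite mul0r; exact: has_cderiv_cst.
under eq_fun do rewrite exprS.
apply: has_cderiv_eq (has_cderivM (has_cderiv_id z) IH) _.
by rewrite -pred_Sn -[n.+1%:R]natr1; case: n {IH} => [|n];
  rewrite ?expr0 -?pred_Sn ?exprS; ring.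
Qed.

Lemma holX n : hol (fun z : C => z ^+ n).
Proof. by apply: has_hol => z z1; exact: has_cderivX. Qed.

Lemma ccont_real (a b : R) : ccont a b (@cplx_of_real R).
Proof. by apply: (@ccont_pder _ _ _ _ (fun=> 1)) => t _; exact: path_der_real. Qed.

Lemma ccont_realX (a b : R) n : ccont a b (fun t => cplx_of_real t ^+ n : C).
Proof.
elim: n => [|n IH]; first by under eq_fun do rewrite expr0; exact: ccont_cst.
by under eq_fun do rewrite exprS; exact: ccontM (@ccont_real a b) IH.
Qed.

Lemma radius_disk (t : R) (z : C) : 0 <= t <= 1 -> cnorm (cplx_of_real t * z) <= cnorm z.
Proof.
by move=> /andP[t0 t1]; rewrite cnormM cnorm_real ger0_norm// ler_piMl// cnorm_ge0.
Qed.

Lemma ccont_radius (f : C -> C) z : hol f -> cnorm z < 1 ->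
  ccont 0 1 (fun t => f (0 + cplx_of_real t * z)).
Proof.
move=> hf z1; apply: (@ccont_comp _ _ _ (fun t => 0 + cplx_of_real t * z)).
  by apply: (@ccont_pder _ _ _ _ (fun=> z)) => t _; exact: path_der_line.
move=> t t01; apply: hol_continuous => //.
by rewrite add0r (le_lt_trans (radius_disk z t01)).
Qed.

Lemma path_der_radius (f : C -> C) z t : hol f -> cnorm z < 1 -> 0 <= t <= 1 ->
  path_der (fun t => f (0 + cplx_of_real t * z)) t (z * derive1 f (0 + cplx_of_real t *
    z)).
Proof.
move=> hf z1 t01.
apply: (@path_der_comp _ f (fun t => 0 + cplx_of_real t * z) t _ _ (path_der_line _ _ _)).
by apply: hf; rewrite add0r (le_lt_trans (radius_disk z t01)).
Qed.

(** The summand 0 gives the argument the affine form shared by [path_der_line] and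
    [derive_under_cint]. *)
Definition radial (n : nat) (f : C -> C) (z : C) : C :=
  cint 0 1 (fun t => cplx_of_real t ^+ n * f (0 + cplx_of_real t * z)).

(** Differentiating [f (t z)] in [z] produces one more factor [t], whence the shift of the
    exponent. *)
Lemma has_cderiv_radial n f z : hol f -> cnorm z < 1 ->
  has_cderiv (radial n f) z (radial n.+1 (derive1 f) z).
Proof.
move=> hf z1.
have -> : radial n.+1 (derive1 f) z = cint 0 1 (fun t => cplx_of_real t ^+ n *
   cplx_of_real t * derive1 f (0 + cplx_of_real t * z)).
  by apply: eq_cint => t _; rewrite exprSr.
have t1 (t : R) : 0 <= t <= 1 -> cnorm (cplx_of_real t) <= 1.
  by move=> /andP[t0 t1]; rewrite cnorm_real ger0_norm.
apply: (@derive_under_cint _ 0 1 (fun t => cplx_of_real t ^+ n) (fun=> 0)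
  (@cplx_of_real R) f z ((1 + cnorm z) / 2) ((1 - cnorm z) / 2) 1 1) => //.
- exact: ccont_realX.
- exact: ccont_cst.
- exact: ccont_real.
- lra.
- lra.
- move=> t w t01 wz; rewrite add0r (le_trans (radius_disk w t01))//.
  by have := cnormD (w - z) z; rewrite subrK; lra.
- move=> t t01; rewrite cnormX exprn_ile1 ?cnorm_ge0//; exact: t1.
Qed.

Lemma hol_radial n f : hol f -> hol (radial n f).
Proof. by move=> hf; apply: has_hol => z z1; exact: has_cderiv_radial. Qed.

(** Since [g 0 = 0], integrating the derivative of [t |-> g (t z)] over [[0, 1]] gives
    [g z = z * \int_0^1 g'(t z) dt]. The integral is holomorphic at 0 as well, so no singularity has
    to be removed. *)
Lemma hol_div (g : C -> C) : hol g -> g 0 = 0 ->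
  exists2 q, hol q & forall z, cnorm z < 1 -> g z = z * q z.
Proof.
move=> hg g0; have hdg := hol_derive hg.
exists (radial 0 (derive1 g)); first exact: hol_radial.
move=> z z1; rewrite /radial -cintZ; last first.
  by apply: ccontM; [exact: ccont_realX|exact: ccont_radius].
rewrite (@cint_FTC _ _ _ _ (fun t => g (0 + cplx_of_real t * z)))//.
- by rewrite cplx0 cplx1 !add0r mul1r mul0r g0 subr0.
- have := ccontM (@ccont_cst R 0 1 z) (ccontM (@ccont_realX 0 1 0%N) (ccont_radius hdg
  z1)).
  exact.
- by move=> t t01; rewrite expr0 mul1r; exact: path_der_radius.
Qed.

Lemma derive1n_hol k (f : C -> C) : hol f -> hol (derive1n k f).
Proof.
by move=> hf; elim: k => [//|k IH]; exact: hol_derive IH.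
Qed.

Lemma derive1n_ext k (f g : C -> C) : (forall w, cnorm w < 1 -> f w = g w) -> hol f ->
  forall z, cnorm z < 1 -> derive1n k f z = derive1n k g z.
Proof.
move=> fg hf; elim: k => [|k IH] z z1; first exact: fg.
by rewrite (derive1nS f) (derive1nS g); have [_ ->] := hol_ext IH (derive1n_hol k hf).
Qed.

(** At [z = 0] this reduces the derivative of order [k + 1] of the product to a nonzero multiple of
    the derivative of order [k] of [q], so vanishing orders pass to the quotient. *)
Lemma derive1n_mulX k (q : C -> C) : hol q -> forall z, cnorm z < 1 ->
  derive1n k.+1 (fun w => w * q w) z = z * derive1n k.+1 q z + k.+1%:R * derive1n k q z.
Proof.
move=> hq; elim: k => [|k IH] z z1.
  rewrite !derive1n1 derive1n0.
  have [_ ->] := has_cderiv_derivable (has_cderivM (has_cderiv_id z) (hq z z1)); ring.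
rewrite (derive1nS (fun w => w * q w)).
have H := has_cderivD (has_cderivM (has_cderiv_id z) (derive1n_hol k.+1 hq z1))
  (has_cderivM (has_cderiv_cst k.+1%:R z) (derive1n_hol k hq z1)).
have H' := @has_cderiv_disk _ (derive1n k.+1 (fun w => w * q w)) z _ (fun w w1 =>
  esym (IH w w1)) z1 H.
have [_ ->] := has_cderiv_derivable H'.
have key (A B D : C) : 1 * A + z * B + (0 * D + k.+1%:R * A) = z * B + k.+2%:R * A.
  by rewrite -[k.+2%:R]natr1; ring.
exact: key.
Qed.

Lemma hol_factor m (g : C -> C) : hol g -> (forall k, (k < m)%N -> derive1n k g 0 = 0) ->
  exists2 q, hol q & forall z, cnorm z < 1 -> g z = z ^+ m * q z.
Proof.
elim: m g => [|m IH] g hg g0.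
  by exists g => // z _; rewrite expr0 mul1r.
have [q hq gq] := hol_div hg (g0 0%N isT).
have c0 : cnorm (0 : C) < 1 by rewrite cnorm0.
have [||p hp qp] := IH q; first by [].
  move=> k km; have := g0 k.+1 km.
  rewrite (derive1n_ext k.+1 gq hg c0) (derive1n_mulX k hq c0) mul0r add0r => /eqP.
  by rewrite mulf_eq0 pnatr_eq0 => /eqP.
by exists p => // z z1; rewrite gq// qp// exprS mulrA.
Qed.

(** This is the integral over [[0, 1]] of the derivative of [t^(m+1) q(t z)]. It expresses [z S']
    through [q] and [S], and so yields [Q' = h]. *)
Lemma radial_ode m (q : C -> C) z : hol q -> cnorm z < 1 ->
  m.+1%:R * radial m q z + z * radial m.+1 (derive1 q) z = q z.
Proof.
move=> hq z1; have hdq := hol_derive hq.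
have c1 := ccontM (@ccont_realX 0 1 m) (ccont_radius hq z1).
have c2 := ccontM (@ccont_realX 0 1 m.+1) (ccont_radius hdq z1).
have c3 := ccontM (@ccont_cst R 0 1 m.+1%:R) c1.
have c4 := ccontM (@ccont_cst R 0 1 z) c2.
have -> : m.+1%:R * radial m q z + z * radial m.+1 (derive1 q) z =
    cint 0 1 (fun t => m.+1%:R * (cplx_of_real t ^+ m * q (0 + cplx_of_real t * z)) +
      z * (cplx_of_real t ^+ m.+1 * derive1 q (0 + cplx_of_real t * z))).
  by rewrite (cintD c3 c4) (cintZ _ c1) (cintZ _ c2).
have E := @cint_FTC _ 0 1 _ (fun t => cplx_of_real t ^+ m.+1 * q (0 + cplx_of_real t * z))
  ler01 (ccontD c3 c4).
rewrite E {E}.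
  by rewrite cplx0 cplx1 expr1n !mul1r add0r exprS !mul0r subr0.
move=> t t01; apply: path_der_eq (path_derM (path_derX m.+1 (path_der_real t))
  (path_der_radius hq z1 t01)) _.
  rewrite -pred_Sn; ring.
Qed.

(** On the segment [w = t z] the integrand [g(t z) z] is [z^(m+1)] times [t^m q(t z)]. *)
Lemma segment_integral_factor m (g q : C -> C) z : (forall z, cnorm z < 1 -> g z = z ^+
  m * q z) ->
  hol q -> cnorm z < 1 -> segment_integral g z = z ^+ m.+1 * radial m q z.
Proof.
move=> gq hq z1; rewrite /radial -cintZ; last first.
  exact: ccontM (@ccont_realX 0 1 m) (ccont_radius hq z1).
apply: eq_cint => t t01; rewrite gq; last by rewrite (le_lt_trans (radius_disk z t01)).
by rewrite add0r exprMn exprS; ring.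
Qed.

(** The integrand is [(w g)' - c g], and the first term integrates to the boundary value
    [z * g z]. *)
Lemma segment_integral_by_parts (g : C -> C) (c z : C) : hol g -> cnorm z < 1 ->
  segment_integral (fun w => w * derive1 g w - (c - 1) * g w) z =
  z * g z - c * segment_integral g z.
Proof.
move=> hg z1; have hdg := hol_derive hg.
have cg := ccontM (ccont_radius hg z1) (@ccont_cst R 0 1 z).
have cdg := ccontM (ccontM (@ccont_real 0 1) (@ccont_cst R 0 1 z))
  (ccontM (@ccont_cst R 0 1 z) (ccont_radius hdg z1)).
have cG := ccontD cg cdg.
have E1 : cint 0 1 (fun t => g (0 + cplx_of_real t * z) * z
    + cplx_of_real t * z * (z * derive1 g (0 + cplx_of_real t * z))) = z * g z.
  have E := @cint_FTC _ 0 1 _ (fun t => (0 + cplx_of_real t * z) * g (0 + cplx_of_real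
    t * z))
    ler01 cG.
  rewrite E {E}.
    by rewrite cplx0 cplx1 !add0r !mul1r !mul0r subr0.
  move=> t t01; apply: path_der_eq (path_derM (path_der_line 0 z t) (path_der_radius hg
    z1 t01)) _.
  by ring.
have -> : segment_integral g z = cint 0 1 (fun t => g (0 + cplx_of_real t * z) * z).
  by apply: eq_cint => t _; rewrite add0r.
rewrite -E1.
have E2 := cintB cG (ccontM (@ccont_cst R 0 1 c) cg); rewrite (cintZ c cg) in E2.
rewrite -{}E2; apply: eq_cint => t _; rewrite !add0r; ring.
Qed.

End Division.

(** * Area integrals over disks *)

Section PlaneMeasure.
Variable R : realType.
Local Notation C := (Cplx R).
Local Notation P := (plane R).
Local Notation leb := (@lebesgue_measure R).
Local Notation mu2 := (product_measure1 leb leb).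

(** The plane carries the product of two Borel sigma-algebras, so open sets are reached as countable
    unions of boxes with rational corners. Boxes not contained in [U] are replaced by the empty set,
    which lets the union run over all quadruples of rationals. *)
Lemma open_plane_measurable (U : set (R * R)) : open U -> measurable (U : set P).
Proof.
move=> oU.
pose box (i : (rat * rat) * (rat * rat)) : set P :=
  `]ratr i.1.1, ratr i.1.2[ `*` `]ratr i.2.1, ratr i.2.2[.
have -> : U = \bigcup_i (if `[< box i `<=` U >] then box i else set0).
  apply/seteqP; split => [p Up|p [i _]]; last by case: asboolP => // + ?; exact.
  have /nbhs_ballP[e /= e0 He] : nbhs p U by exact: open_nbhs_nbhs.
  have [a /andP[a1 a2]] : exists a : rat, p.1 - e < ratr a < p.1.
    have /rat_in_itvoo[a] : p.1 - e < p.1 by rewrite ltrBlDr ltrDl.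
    by rewrite in_itv; exists a.
  have [b /andP[b1 b2]] : exists a : rat, p.1 < ratr a < p.1 + e.
    have /rat_in_itvoo[a'] : p.1 < p.1 + e by rewrite ltrDl.
    by rewrite in_itv; exists a'.
  have [c /andP[c1 c2]] : exists a : rat, p.2 - e < ratr a < p.2.
    have /rat_in_itvoo[a'] : p.2 - e < p.2 by rewrite ltrBlDr ltrDl.
    by rewrite in_itv; exists a'.
  have [d /andP[d1 d2]] : exists a : rat, p.2 < ratr a < p.2 + e.
    have /rat_in_itvoo[a'] : p.2 < p.2 + e by rewrite ltrDl.
    by rewrite in_itv; exists a'.
  exists ((a, b), (c, d)) => //.
  case: asboolP => [_|]; first by split; rewrite /= in_itv/= ?a2 ?b1 ?c2 ?d1.
  case=> q [] /=; rewrite !in_itv/= => /andP[q1 q2] /andP[q3 q4].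
  apply: He; split; rewrite /ball /= ltr_norml; lra.
apply: countable_bigcupT_measurable => // i.
case: asboolP => // _; apply: measurableX; exact: measurable_itv.
Qed.

Lemma open_continuous_plane_measurable (f : R * R -> R) (D : set (R * R)) : open D ->
  (forall p, D p -> {for p, continuous f}) -> measurable_fun (D : set P) (f : P -> R).
Proof.
move=> oD cf; apply: (measurability _ (RGenOpens.measurableE R)).
move=> _ [_ [a [b ->] <-]]; apply: open_plane_measurable.
rewrite openE => p [Dp fp]; rewrite /interior.
apply: filterI; first exact: open_nbhs_nbhs.
by apply: cf => //; apply: open_nbhs_nbhs; split => //; exact: interval_open.
Qed.

Lemma cvg_cplx_of_plane (p : R * R) :
  (fun q : R * R => cplx_of_plane (q : P)) @ nbhs p --> cplx_of_plane (p : P).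
Proof. by apply: cvgC => /=; [exact: cvg_fst|exact: cvg_snd]. Qed.

Definition pdisk (r : R) : set P := [set p | cnorm (cplx_of_plane p) < r].

Lemma plane_diskE : @plane_disk R = pdisk 1.
Proof. by apply/seteqP; split => p /diskE. Qed.

Lemma pdisk_open (r : R) : open (pdisk r : set (R * R)).
Proof.
have -> : pdisk r = (fun p : R * R => cnorm (cplx_of_plane (p : P))) @^-1` [set x | x <
  r] by [].
apply: open_comp; last exact: open_lt.
move=> p _; apply: cvg_cRe; apply: cvg_norm; exact: cvg_cplx_of_plane.
Qed.

Lemma pdisk_measurable (r : R) : measurable (pdisk r).
Proof. by apply: open_plane_measurable; exact: pdisk_open. Qed.

Lemma cvg_plane (F : C -> C) (p : R * R) : {for cplx_of_plane (p : P), continuous F} ->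
  (fun q : R * R => F (cplx_of_plane (q : P))) @ nbhs p --> F (cplx_of_plane (p : P)).
Proof. move=> cF; exact: (@cvg_comp _ _ _ _ F _ _ _ (@cvg_cplx_of_plane p) cF). Qed.

Lemma measurable_continuousC (F : C -> C) (r : R) :
  (forall z, cnorm z < r -> {for z, continuous F}) ->
  measurable_fun (pdisk r) (@cRe R \o F \o @cplx_of_plane R) /\
  measurable_fun (pdisk r) (@cIm R \o F \o @cplx_of_plane R).
Proof.
move=> cF; split; apply: (open_continuous_plane_measurable (@pdisk_open r)) => p pr.
  by apply: cvg_cRe; apply: cvg_plane; exact: cF.
by apply: cvg_cIm; apply: cvg_plane; exact: cF.
Qed.

Lemma mu2_pdisk_fin (r : R) : (mu2 (pdisk r) < +oo)%E.
Proof.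
have [r0|r0] := leP r 0.
  rewrite [pdisk r](_ : _ = set0) ?measure0//.
  by apply/seteqP; split => p //; rewrite /pdisk /= => h;
    have := cnorm_ge0 (cplx_of_plane p); lra.
have sub : pdisk r `<=` `[- r, r] `*` `[- r, r].
  move=> p /= pr; split => /=; rewrite in_itv/= -ler_norml.
    exact: le_trans (cRe_le (cplx_of_plane p)) (ltW pr).
  exact: le_trans (cIm_le (cplx_of_plane p)) (ltW pr).
apply: (@le_lt_trans _ _ (mu2 (`[- r, r] `*` `[- r, r]))).
  apply: le_measure => //; rewrite inE; first exact: pdisk_measurable.
  by apply: measurableX.
rewrite product_measure1E//= !lebesgue_measure_itv/=.
by case: ifP => _; rewrite -?EFinB -?EFinM ltry.
Qed.

Lemma dA_pdisk_fin (r : R) : (@dA R (pdisk r) < +oo)%E.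
Proof.
by rewrite /dA /= /mscale lte_mul_pinfty// ?mu2_pdisk_fin//= invr_ge0 pi_ge0.
Qed.

Lemma bounded_integrable_disk (mu : {measure set P -> \bar R}) (f : P -> R) (r M : R) :
  (mu (pdisk r) < +oo)%E ->
  measurable_fun (pdisk r) f -> (forall p, pdisk r p -> `|f p| <= M) ->
  mu.-integrable (pdisk r) (EFin \o f).
Proof.
move=> mf mfun fM; apply: measurable_bounded_integrable => //;
  first exact: pdisk_measurable.
exists M; split; first exact: num_real.
by move=> x Mx p /= pr; rewrite (le_trans (fM p pr))// ltW.
Qed.

(** * Fubini on a disk for derivatives of functions that vanish on the circle *)

Lemma slice_integral0 (v dv : R -> R) (a : R) : 0 < a ->
  (forall y, - a <= y <= a -> is_derive y (1 : R) v (dv y)) ->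
  {within `[- a, a], continuous dv} -> v a = v (- a) ->
  (\int[leb]_y ((dv \_ `]- a, a[) y)%:E)%E = 0%E.
Proof.
move=> a0 Hv cdv vv.
have ab : - a <= a by lra.
have -> : (\int[leb]_y ((dv \_ `]- a, a[) y)%:E = \int[leb]_(y in `](- a)%R, a[) (EFin
  \o dv) y)%E.
  by rewrite [RHS]integral_mkcond; under [RHS]eq_integral do rewrite restrict_EFin.
have fi := itv_integrable cdv.
rewrite -(@integral_itv_bndoo _ (- a) a _ true false); last first.
  apply: measurable_funS (measurable_int _ fi) => //.
  by apply: subset_itvW.
have := Rint_FTC ab cdv Hv; rewrite vv subrr /Rintegral => h.
by rewrite -[LHS]fineK ?integrable_fin_num// h.
Qed.

Lemma pdisk_slice (r x y : R) : pdisk r (x, y) <->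
  0 < r /\ x ^+ 2 < r ^+ 2 /\ y \in `]- Num.sqrt (r ^+ 2 - x ^+ 2), Num.sqrt (r ^+ 2 -
    x ^+ 2)[.
Proof.
rewrite /pdisk /= in_itv/= -ltr_norml.
have cn2 := cnorm_sqr (cplx_of_plane ((x, y) : P)); rewrite /cRe /cIm /= in cn2.
have n0 := cnorm_ge0 (cplx_of_plane ((x, y) : P)).
split => [h|[r0 [xr]]].
  have r0 : 0 < r by exact: le_lt_trans n0 h.
  have h2 : x ^+ 2 + y ^+ 2 < r ^+ 2 by rewrite -cn2 ltr_pXn2r// nnegrE// ltW.
  split => //; split; first by have := sqr_ge0 y; lra.
  rewrite -sqrtr_sqr ltr_sqrt; first lra.
  by have := sqr_ge0 y; lra.
rewrite -sqrtr_sqr ltr_sqrt ?subr_gt0// => h.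
by rewrite -(@ltr_pXn2r _ 2)// ?nnegrE ?ltW// cn2; lra.
Qed.

Lemma pdisk_swap (r x y : R) : pdisk r (x, y) <-> pdisk r (y, x).
Proof. by rewrite /pdisk /= !cnormE /cRe /cIm /= addrC. Qed.

Section Slices.
Variables (u du : R * R -> R) (rho : R).
Hypothesis rho0 : 0 < rho.
Let cn (p : R * R) := cnorm (cplx_of_plane (p : P)).
Hypothesis cdu : forall p, cn p <= rho -> {for p, continuous du}.
Hypothesis ubd : forall p, cn p = rho -> u p = 0.
Hypothesis dui : mu2.-integrable (pdisk rho) (EFin \o du).

Let edge (x a : R) : x ^+ 2 < rho ^+ 2 -> a = Num.sqrt (rho ^+ 2 - x ^+ 2) ->
  [/\ 0 < a, x ^+ 2 + a ^+ 2 = rho ^+ 2 &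
   forall y, - a <= y <= a -> x ^+ 2 + y ^+ 2 <= rho ^+ 2].
Proof.
move=> xr ->; have s0 : 0 < rho ^+ 2 - x ^+ 2 by rewrite subr_gt0.
split; first by rewrite sqrtr_gt0.
  by rewrite sqr_sqrtr ?ltW// addrC subrK.
move=> y; rewrite -ler_norml => h.
have : y ^+ 2 <= rho ^+ 2 - x ^+ 2.
  rewrite -(sqr_sqrtr (ltW s0)) -[y ^+ 2]real_normK ?num_real//.
  by rewrite ler_pXn2r ?nnegrE ?sqrtr_ge0.
lra.
Qed.

Let cn_eq x y : x ^+ 2 + y ^+ 2 = rho ^+ 2 -> cn (x, y) = rho.
Proof. by rewrite /cn cnormE /cRe /cIm /= => ->; rewrite sqrtr_sqr gtr0_norm. Qed.

Let cn_le x y : x ^+ 2 + y ^+ 2 <= rho ^+ 2 -> cn (x, y) <= rho.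
Proof.
move=> h; rewrite /cn cnormE /cRe /cIm /= -(gtr0_norm rho0).
by rewrite -sqrtr_sqr ler_wsqrtr.
Qed.

Let dui' : mu2.-integrable setT (EFin \o (du \_ (pdisk rho))).
Proof. by rewrite -restrict_EFin; exact: ((integrable_mkcond _ (pdisk_measurable
  rho)).1 dui). Qed.

Let int_restrict : (\int[mu2]_(p in pdisk rho) (du p)%:E =
  \int[mu2]_p (EFin \o (du \_ (pdisk rho))) p)%E.
Proof. by rewrite integral_mkcond; under eq_integral do rewrite restrict_EFin. Qed.

(** The vertical slice of the disk at [x] is empty or an open chord whose ends lie on the circle,
    where [u] is zero. Each inner integral of Fubini is therefore zero by the fundamental theorem of
    calculus. *)
Lemma pdisk_integral_dy0 :
  (forall p, cn p <= rho -> is_derive p.2 (1 : R) (fun y => u (p.1, y)) (du p)) ->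
  (\int[mu2]_(p in pdisk rho) (du p)%:E)%E = 0%E.
Proof.
move=> Hu; rewrite int_restrict -integral12_prod_meas1//.
apply: integral0_eq => x _; rewrite /fubini_F.
have [xr|xr] := ltP (x ^+ 2) (rho ^+ 2); last first.
  apply: integral0_eq => y _ /=; congr EFin; rewrite /patch; case: ifPn => //.
  by rewrite inE => /pdisk_slice[_ [+ _]]; rewrite ltNge xr.
set a := Num.sqrt (rho ^+ 2 - x ^+ 2).
have [a0 ae ale] := edge xr (erefl a).
transitivity (\int[leb]_y (((fun y => du (x, y)) \_ `]- a, a[) y)%:E)%E.
  apply: eq_integral => y _ /=; congr EFin; rewrite /patch.
  congr (if _ then _ else _); apply/idP/idP; rewrite !inE.
    by move=> /pdisk_slice[_ []].
  by move=> h; apply/pdisk_slice.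
apply: (@slice_integral0 (fun y => u (x, y)) _ a a0).
- by move=> y /ale /cn_le; exact: Hu.
- apply/subspace_continuousP => y /=; rewrite in_itv/= => /ale /cn_le h.
  apply: cvg_within_filter.
  have h1 : (fun t : R => (x, t)) @ nbhs y --> ((x, y) : R * R).
    move=> S [[B1 B2] /= [hB1 hB2] sub]; apply: (filterS _ hB2) => t Bt.
    by apply: sub; split => //=; exact: nbhs_singleton hB1.
  exact: (@cvg_comp _ _ _ _ du _ _ _ h1 (cdu h)).
- by rewrite !ubd//; apply: cn_eq; rewrite ?sqrrN.
Qed.

Lemma pdisk_integral_dx0 :
  (forall p, cn p <= rho -> is_derive p.1 (1 : R) (fun x => u (x, p.2)) (du p)) ->
  (\int[mu2]_(p in pdisk rho) (du p)%:E)%E = 0%E.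
Proof.
move=> Hu; rewrite int_restrict -integral21_prod_meas1//.
apply: integral0_eq => y _; rewrite /fubini_G.
have [yr|yr] := ltP (y ^+ 2) (rho ^+ 2); last first.
  apply: integral0_eq => x _ /=; congr EFin; rewrite /patch; case: ifPn => //.
  by rewrite inE => /pdisk_swap/pdisk_slice[_ [+ _]]; rewrite ltNge yr.
set a := Num.sqrt (rho ^+ 2 - y ^+ 2).
have [a0 ae ale] := edge yr (erefl a).
transitivity (\int[leb]_x (((fun x => du (x, y)) \_ `]- a, a[) x)%:E)%E.
  apply: eq_integral => x _ /=; congr EFin; rewrite /patch.
  congr (if _ then _ else _); apply/idP/idP; rewrite !inE.
    by move=> /pdisk_swap/pdisk_slice[_ []].
  by move=> h; apply/pdisk_swap/pdisk_slice.
have {}ale x : - a <= x <= a -> cn (x, y) <= rho.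
  by move=> /ale h; apply: cn_le; rewrite addrC.
apply: (@slice_integral0 (fun x => u (x, y)) _ a a0).
- by move=> x /ale; exact: Hu.
- apply/subspace_continuousP => x /=; rewrite in_itv/= => /ale h.
  apply: cvg_within_filter.
  have h1 : (fun t : R => (t, y)) @ nbhs x --> ((x, y) : R * R).
    move=> S [[B1 B2] /= [hB1 hB2] sub]; apply: (filterS _ hB1) => t Bt.
    by apply: sub; split => //=; exact: nbhs_singleton hB2.
  exact: (@cvg_comp _ _ _ _ du _ _ _ h1 (cdu h)).
- by rewrite !ubd//; apply: cn_eq; rewrite ?sqrrN addrC.
Qed.

End Slices.

(** The positive and negative parts of [f] have the same finite integral for Lebesgue measure, and
    scaling the measure by [1 / pi] preserves this equality. *)
Lemma integral_dA0 (r : R) (f : P -> R) : mu2.-integrable (pdisk r) (EFin \o f) ->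
  (\int[mu2]_(p in pdisk r) (f p)%:E)%E = 0%E -> Rintegral (@dA R) (pdisk r) f = 0.
Proof.
move=> fi f0; rewrite /Rintegral.
have mf := measurable_int _ fi.
have mD := pdisk_measurable r.
rewrite integralE ge0_integral_mscale//; last exact: measurable_funepos.
rewrite ge0_integral_mscale//; last exact: measurable_funeneg.
have fp := integrable_pos_fin_num mD fi; have fn := integrable_neg_fin_num mD fi.
have : (\int[mu2]_(p in pdisk r) (EFin \o f)^\+ p =
   \int[mu2]_(p in pdisk r) (EFin \o f)^\- p)%E.
  by move: f0; rewrite [X in X = _]integralE => /eqP;
    rewrite sube_eq ?add0e ?fin_num_adde_defl// => /eqP.
by move=> ->; rewrite subee// fin_numM.
Qed.

End PlaneMeasure.

(** * Green's formula on disks *)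

Section DiskIntegral.
Variable R : realType.
Local Notation C := (Cplx R).
Local Notation P := (plane R).
Local Notation dA := (@dA R).
Local Notation ci := (ci R).
Local Notation leb := (@lebesgue_measure R).
Local Notation mu2 := (product_measure1 leb leb).

Definition cont_disk (F : C -> C) := forall z, cnorm z < 1 -> {for z, continuous F}.

Lemma hol_cont_disk (f : C -> C) : hol f -> cont_disk f.
Proof. by move=> hf z; exact: hol_continuous. Qed.

Lemma cont_diskM (F G : C -> C) : cont_disk F -> cont_disk G -> cont_disk (fun z =>
  F z * G z).
Proof. by move=> cF cG z z1; exact: cvgM (cF z z1) (cG z z1). Qed.

Lemma cont_diskD (F G : C -> C) : cont_disk F -> cont_disk G -> cont_disk (fun z =>
  F z + G z).
Proof. by move=> cF cG z z1; exact: cvgD (cF z z1) (cG z z1). Qed.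

Lemma cont_diskB (F G : C -> C) : cont_disk F -> cont_disk G -> cont_disk (fun z =>
  F z - G z).
Proof. by move=> cF cG z z1; exact: cvgB (cF z z1) (cG z z1). Qed.

Lemma cont_disk_conj (F : C -> C) : cont_disk F -> cont_disk (fun z => (F z)^*).
Proof. by move=> cF z z1; exact: cvg_conj (cF z z1). Qed.

Lemma cont_disk_cst (k : C) : cont_disk (fun=> k).
Proof. by move=> z _; exact: cst_continuous. Qed.

Definition disk_integrable (r : R) (F : C -> C) :=
  dA.-integrable (pdisk r) (EFin \o (fun p => cRe (F (cplx_of_plane p)))) /\
  dA.-integrable (pdisk r) (EFin \o (fun p => cIm (F (cplx_of_plane p)))).

Definition disk_integral (r : R) (F : C -> C) : C :=
  cintegral dA (pdisk r) (fun p => F (cplx_of_plane p)).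

Lemma eq_disk_integral r F G : (forall z, cnorm z < r -> F z = G z) ->
  disk_integral r F = disk_integral r G.
Proof.
by move=> FG; congr Complex; apply: eq_Rintegral => p; rewrite inE => pr /=; rewrite FG.
Qed.

Lemma disk_integrableD r F G : disk_integrable r F -> disk_integrable r G ->
  disk_integrable r (fun z => F z + G z).
Proof.
move=> [F1 F2] [G1 G2]; have mD := pdisk_measurable r; split.
  apply: eq_integrable (integrableD mD F1 G1) => //.
  by move=> p _ /=; rewrite cReD.
apply: eq_integrable (integrableD mD F2 G2) => //.
by move=> p _ /=; rewrite cImD.
Qed.

Lemma disk_integralD r F G : disk_integrable r F -> disk_integrable r G ->
  disk_integral r (fun z => F z + G z) = disk_integral r F + disk_integral r G.
Proof.
move=> [F1 F2] [G1 G2]; have mD := pdisk_measurable r; apply: cplxP.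
  rewrite cReD /= -RintegralD//.
  by apply: eq_Rintegral => t _; rewrite /= cReD.
rewrite cImD /= -RintegralD//.
by apply: eq_Rintegral => t _; rewrite /= cImD.
Qed.

Lemma disk_integrableZ r k F : disk_integrable r F ->
  disk_integrable r (fun z => k * F z).
Proof.
move=> [F1 F2]; have mD := pdisk_measurable r; split.
  apply: eq_integrable (integrableB mD (integrableZl mD (cRe k) F1)
    (integrableZl mD (cIm k) F2)) => //.
  by move=> p _ /=; rewrite cReM EFinB !EFinM.
apply: eq_integrable (integrableD mD (integrableZl mD (cRe k) F2)
    (integrableZl mD (cIm k) F1)) => //.
by move=> p _ /=; rewrite cImM EFinD !EFinM.
Qed.

Lemma disk_integralZ r k F : disk_integrable r F ->
  disk_integral r (fun z => k * F z) = k * disk_integral r F.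
Proof.
move=> [F1 F2]; have mD := pdisk_measurable r.
have Z (c : R) (f : P -> R) : dA.-integrable (pdisk r) (EFin \o f) ->
    dA.-integrable (pdisk r) (EFin \o (fun p => c * f p)).
  by move=> fi; apply: eq_integrable (integrableZl mD c fi) => // p _ /=; rewrite EFinM.
apply: cplxP.
  rewrite cReM /= -!RintegralZl// -RintegralB//; try exact: Z.
  by apply: eq_Rintegral => t _; rewrite /= cReM.
rewrite cImM /= -!RintegralZl// -RintegralD//; try exact: Z.
by apply: eq_Rintegral => t _; rewrite /= cImM.
Qed.

Lemma disk_integrableB r F G : disk_integrable r F -> disk_integrable r G ->
  disk_integrable r (fun z => F z - G z).
Proof.
move=> iF iG; have := disk_integrableD iF (disk_integrableZ (-1) iG).
by under eq_fun do rewrite mulN1r.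
Qed.

Lemma disk_integralB r F G : disk_integrable r F -> disk_integrable r G ->
  disk_integral r (fun z => F z - G z) = disk_integral r F - disk_integral r G.
Proof.
move=> iF iG; have := disk_integralD iF (disk_integrableZ (-1) iG).
by rewrite (disk_integralZ _ iG) mulN1r; under eq_fun do rewrite mulN1r.
Qed.

Lemma bounded_disk_integrable (mu : {measure set P -> \bar R}) (r : R) F :
  (mu (pdisk r) < +oo)%E -> r < 1 -> cont_disk F ->
  mu.-integrable (pdisk r) (EFin \o (fun p => cRe (F (cplx_of_plane p)))) /\
  mu.-integrable (pdisk r) (EFin \o (fun p => cIm (F (cplx_of_plane p)))).
Proof.
move=> mr r1 cF.
have [M _ HM] : exists2 M : R, 0 <= M & forall z, cnorm z <= r -> cnorm (F z) <= M.
  by apply: cont_bounded => z zr; apply: cF; exact: le_lt_trans zr r1.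
have [m1 m2] : measurable_fun (pdisk r) (@cRe R \o F \o @cplx_of_plane R) /\
  measurable_fun (pdisk r) (@cIm R \o F \o @cplx_of_plane R).
  by apply: measurable_continuousC => z zr; apply: cF; exact: lt_trans zr r1.
split; apply: (bounded_integrable_disk mr _ (M := M)) => //.
  by move=> p pr; rewrite (le_trans (cRe_le _))// HM// ltW.
by move=> p pr; rewrite (le_trans (cIm_le _))// HM// ltW.
Qed.

Lemma cont_disk_integrable (r : R) F : r < 1 -> cont_disk F -> disk_integrable r F.
Proof. by move=> r1 cF; apply: bounded_disk_integrable => //; exact: dA_pdisk_fin. Qed.

Lemma cplx_eta (z : C) : Complex (cRe z) (cIm z) = z.
Proof. by case: z. Qed.

(** The integrand is twice the d-bar derivative of [U]. As [U] is zero on the circle, each partial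
    derivative integrates to zero on its own: Green's formula with vanishing boundary term. *)
Lemma disk_integral_dbar (U Ux Uy : C -> C) (rho : R) : 0 < rho -> rho < 1 ->
  cont_disk Ux -> cont_disk Uy ->
  (forall z, cnorm z <= rho -> path_der (fun x =>
    U (Complex x (cIm z))) (cRe z) (Ux z)) ->
  (forall z, cnorm z <= rho -> path_der (fun y =>
    U (Complex (cRe z) y)) (cIm z) (Uy z)) ->
  (forall z, cnorm z = rho -> U z = 0) ->
  disk_integral rho (fun z => Ux z + ci * Uy z) = 0.
Proof.
move=> r0 r1 cx cy dx dy U0.
have ix := cont_disk_integrable r1 cx; have iy := cont_disk_integrable r1 cy.
rewrite (disk_integralD ix (disk_integrableZ ci iy)) (disk_integralZ ci iy).
have [mx1 mx2] := bounded_disk_integrable (mu2_pdisk_fin rho) r1 cx.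
have [my1 my2] := bounded_disk_integrable (mu2_pdisk_fin rho) r1 cy.
have cR F (p : R * R) : cont_disk F -> cnorm (cplx_of_plane (p : P)) <= rho ->
    {for p, continuous (fun q : R * R => cRe (F (cplx_of_plane (q : P))))}.
  by move=> cF pr; apply: cvg_cRe; apply: cvg_plane; apply: cF; exact: le_lt_trans pr r1.
have cI F (p : R * R) : cont_disk F -> cnorm (cplx_of_plane (p : P)) <= rho ->
    {for p, continuous (fun q : R * R => cIm (F (cplx_of_plane (q : P))))}.
  by move=> cF pr; apply: cvg_cIm; apply: cvg_plane; apply: cF; exact: le_lt_trans pr r1.
have -> : disk_integral rho Ux = 0.
  apply: cplxP; rewrite /disk_integral /=; apply: integral_dA0 => //.
    apply: (pdisk_integral_dx0 (u := fun p => cRe (U (cplx_of_plane (p : P))))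
      (du := fun p => cRe (Ux (cplx_of_plane (p : P)))) r0) => //.
    - by move=> p; exact: cR.
    - by move=> p /U0 ->.
    - by move=> p /dx[].
  apply: (pdisk_integral_dx0 (u := fun p => cIm (U (cplx_of_plane (p : P))))
      (du := fun p => cIm (Ux (cplx_of_plane (p : P)))) r0) => //.
  - by move=> p; exact: cI.
  - by move=> p /U0 ->.
  - by move=> p /dx[].
have -> : disk_integral rho Uy = 0.
  apply: cplxP; rewrite /disk_integral /=; apply: integral_dA0 => //.
    apply: (pdisk_integral_dy0 (u := fun p => cRe (U (cplx_of_plane (p : P))))
      (du := fun p => cRe (Uy (cplx_of_plane (p : P)))) r0) => //.
    - by move=> p; exact: cR.
    - by move=> p /U0 ->.
    - by move=> p /dy[].
  apply: (pdisk_integral_dy0 (u := fun p => cIm (U (cplx_of_plane (p : P))))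
      (du := fun p => cIm (Uy (cplx_of_plane (p : P)))) r0) => //.
  - by move=> p; exact: cI.
  - by move=> p /U0 ->.
  - by move=> p /dy[].
by rewrite mulr0 addr0.
Qed.

Lemma ci_sqr : ci * ci = -1.
Proof. by apply: cplxP; rewrite ?cReM ?cImM ?cReN ?cImN /=; ring. Qed.

Lemma ci_conj : ci^* = - ci.
Proof. by apply: cplxP; rewrite ?cRe_conj ?cIm_conj ?cReN ?cImN /= ?oppr0. Qed.

Definition adj_fun (m : nat) (q : C -> C) (z : C) : C := q z - m%:R * radial m q z.

Lemma hol_adj_fun m q : hol q -> hol (adj_fun m q).
Proof. by move=> hq; exact: holB hq (holM (@hol_cst R m%:R) (hol_radial m hq)). Qed.

(* With the notation of the header, [radial m q] is S and [adj_fun m q] is h. *)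
Lemma disk_adjoint_identity (m : nat) (f q : C -> C) (rho : R) :
  hol f -> hol q -> 0 < rho -> rho < 1 ->
  disk_integral rho (fun z => z ^+ m * f z * (z ^+ m * q z)^*) =
  cplx_of_real (rho ^+ (2 * m)) * disk_integral rho (fun z => f z * (adj_fun m q z)^*).
Proof.
move=> hf hq r0 r1.
pose Q (z : C) := z * radial m q z.
have dQ z : cnorm z < 1 -> has_cderiv Q z (adj_fun m q z).
  move=> z1; apply: has_cderiv_eq (has_cderivM (has_cderiv_id z) (has_cderiv_radial m
    hq z1)) _.
  by rewrite /adj_fun -(radial_ode m hq z1) -[m.+1%:R]natr1; ring.
have hQ : hol Q by apply: has_hol dQ.
have hh := hol_adj_fun m hq.
set c := cplx_of_real (rho ^+ (2 * m)).
(* The weight [|z|^(2m) - rho^(2m)] is written with conjugates, so that the product rule applies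
   factor by factor. *)
pose W (z : C) := z ^+ m * (z ^+ m)^* - c.
pose U (z : C) := f z * (Q z)^* * W z.
pose X (z : C) : C := m%:R * z ^+ m.-1.
(* The derivative of [U] in the direction [v], which will be 1 or [ci]: a holomorphic factor
   contributes [v] times its derivative, a conjugated factor the conjugate of that. *)
pose dU v (z : C) := (v * derive1 f z * (Q z)^* + f z * (v * adj_fun m q z)^*) * W z
  + f z * (Q z)^* * (v * X z * (z ^+ m)^* + z ^+ m * (v * X z)^*).
have pU (gam : R -> C) t v z : path_der gam t v -> gam t = z -> cnorm z < 1 ->
    path_der (fun s => U (gam s)) t (dU v z).
  move=> dg gz z1.
  have dgz F d : has_cderiv F z d -> path_der (fun s => F (gam s)) t (v * d).
    by rewrite -gz => HF; exact: (path_der_comp dg HF).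
  have p1 := dgz _ _ (hf z z1); have p2 := path_der_conj (dgz _ _ (dQ z z1)).
  have p3 := dgz _ _ (has_cderivX z m).
  have p4 := path_derB (path_derM p3 (path_der_conj p3)) (path_der_cst c t).
  apply: path_der_eq (path_derM (path_derM p1 p2) p4) _.
  by rewrite /= gz /dU /W /X; ring.
have cW : cont_disk W.
  apply: cont_diskB; last exact: cont_disk_cst.
  by apply: cont_diskM; [|apply: cont_disk_conj]; apply: hol_cont_disk; exact: holX.
have cX : cont_disk X.
  by apply: cont_diskM; [exact: cont_disk_cst|apply: hol_cont_disk; exact: holX].
have cXm : cont_disk (fun z => z ^+ m) by apply: hol_cont_disk; exact: holX.
have cf := hol_cont_disk hf; have cdf := hol_cont_disk (hol_derive hf).
have cQ := hol_cont_disk hQ; have ch := hol_cont_disk hh.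
have cdU v : cont_disk (dU v).
  have cv := @cont_disk_cst v.
  exact: cont_diskD
    (cont_diskM (cont_diskD (cont_diskM (cont_diskM cv cdf) (cont_disk_conj cQ))
      (cont_diskM cf (cont_disk_conj (cont_diskM cv ch)))) cW)
    (cont_diskM (cont_diskM cf (cont_disk_conj cQ))
      (cont_diskD (cont_diskM (cont_diskM cv cX) (cont_disk_conj cXm))
        (cont_diskM cXm (cont_disk_conj (cont_diskM cv cX))))).
have := @disk_integral_dbar U (dU 1) (dU ci) rho r0 r1 (cdU 1) (cdU ci).
have lt1 z : cnorm z <= rho -> cnorm z < 1 by move=> zr; exact: le_lt_trans zr r1.
move=> /(_ (fun z zr => pU _ _ _ z (path_der_hline _ _) (cplx_eta z) (lt1 z zr))).
move=> /(_ (fun z zr => pU _ _ _ z (path_der_vline _ _) (cplx_eta z) (lt1 z zr))).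
have U0 z : cnorm z = rho -> U z = 0.
  move=> zr; rewrite /U /W mulr_conjE cnormX zr -exprM mulnC /c subrr mulr0//.
move=> /(_ U0).
have i1 : disk_integrable rho (fun z => z ^+ m * f z * (z ^+ m * q z)^*).
  exact: (cont_disk_integrable r1 (cont_diskM (cont_diskM cXm cf)
    (cont_disk_conj (cont_diskM cXm (hol_cont_disk hq))))).
have i2 : disk_integrable rho (fun z => f z * (adj_fun m q z)^*).
  exact: (cont_disk_integrable r1 (cont_diskM cf (cont_disk_conj ch))).
have i3 := disk_integrableZ c i2.
have -> : disk_integral rho (fun z => dU 1 z + ci * dU ci z) =
   disk_integral rho (fun z => 2 * (z ^+ m * f z * (z ^+ m * q z)^* - c * (f z *
     (adj_fun m q z)^*))).
  apply: eq_disk_integral => z zr.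
  (* This is [(z^m Q)' = g], by the product rule for the left-hand side; the case [m = 0] is
     separate because of [m.-1]. *)
  have zm : X z * Q z + z ^+ m * adj_fun m q z = z ^+ m * q z.
    rewrite /X /Q /adj_fun; case: (m) => [|k]; first by rewrite expr0; ring.
    by rewrite -pred_Sn exprS; ring.
  have conjM (a b : C) : (a * b)^* = a^* * b^* by exact: rmorphM.
  have conjD (a b : C) : (a + b)^* = a^* + b^* by exact: rmorphD.
  have conj1 : (1 : C)^* = 1 by exact: rmorph1.
  rewrite -zm /dU /W conjD conjM (conjM (z ^+ m)).
  rewrite (conjM 1 (adj_fun m q z)) (conjM ci (adj_fun m q z)) (conjM 1 (X z)) (conjM
    ci (X z)).
  rewrite ci_conj conj1.
  (* For [ring] the symbol [ci] is an indeterminate, so [1 + ci * ci] is kept as a factor.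
     Derivatives of holomorphic factors carry [1 + ci * ci], those of conjugated factors carry
     [1 - ci * ci], which is written [2 - (1 + ci * ci)]. *)
  transitivity (2 * (f z * (adj_fun m q z)^* * (z ^+ m * (z ^+ m)^* - c) + f z * (Q
    z)^* * (z ^+ m * (X z)^*))
    + (1 + ci * ci) * (derive1 f z * (Q z)^* * (z ^+ m * (z ^+ m)^* - c) + f z * (Q
      z)^* * (X z * (z ^+ m)^*))
    - (1 + ci * ci) * (f z * (adj_fun m q z)^* * (z ^+ m * (z ^+ m)^* - c) + f z * (Q
      z)^* * (z ^+ m * (X z)^*))).
    by ring.
  by rewrite ci_sqr; ring.
rewrite (disk_integralZ _ (disk_integrableB i1 i3)) (disk_integralB i1 i3)
  (disk_integralZ _ i2).
by move=> /eqP; rewrite mulf_eq0 pnatr_eq0 /= subr_eq0 => /eqP.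
Qed.

End DiskIntegral.

(** * The Bergman space *)

Section Bergman.
Variable R : realType.
Local Notation C := (Cplx R).
Local Notation P := (plane R).
Local Notation dA := (@dA R).

Definition normsq (f : C -> C) (p : P) : R := cnorm (f (cplx_of_plane p)) ^+ 2.

Definition sq_integrable f := dA.-integrable (pdisk 1) (EFin \o normsq f).

Lemma cRe_sqr_norm (z : C) : cRe (`|z| ^+ 2) = cnorm z ^+ 2.
Proof. by rewrite normE -cplxX. Qed.

Lemma measurable_normsq (f : C -> C) : cont_disk f -> measurable_fun (pdisk 1) (normsq f).
Proof.
move=> cf; have cF : cont_disk (fun z => f z * (f z)^*).
  exact: cont_diskM cf (cont_disk_conj cf).
have [m1 _] := measurable_continuousC (r := 1) cF.
by apply: eq_measurable_fun m1 => p _; rewrite /= /normsq mulr_conjE.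
Qed.

Lemma normsq_ge0 f p : 0 <= normsq f p.
Proof. exact: sqr_ge0. Qed.

(** Measurability in the definition follows from continuity, which leaves holomorphy and
    integrability of the squared modulus. *)
Lemma bergmanP (f : C -> C) : bergman f <-> hol f /\ sq_integrable f.
Proof.
split=> [[[m1 m2 fi] df]|[hf fi]].
  have hf : hol f by move=> z z1; apply: derivable_has_cderiv; apply: df; exact/diskE.
  split=> //; apply/integrableP; split.
    by apply/measurable_EFinP; apply: measurable_normsq; exact: hol_cont_disk.
  rewrite plane_diskE in fi; apply: le_lt_trans fi.
  rewrite le_eqVlt; apply/orP; left; apply/eqP; apply: eq_integral => p _.
  by rewrite cRe_sqr_norm /= ger0_norm// normsq_ge0.
split; last by move=> z /diskE z1; case: (has_cderiv_derivable (hf z z1)).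
rewrite /L2_disk plane_diskE.
have [m1 m2] := measurable_continuousC (r := 1) (hol_cont_disk hf).
split=> //.
move/integrableP : fi => [_]; apply: le_lt_trans.
rewrite le_eqVlt; apply/orP; left; apply/eqP; apply: eq_integral => p _.
by rewrite cRe_sqr_norm /= ger0_norm// normsq_ge0.
Qed.

Lemma dominated_disk_integrable F (G : P -> R) : cont_disk F ->
  dA.-integrable (pdisk 1) (EFin \o G) ->
  (forall p, pdisk 1 p -> cnorm (F (cplx_of_plane p)) <= G p) -> disk_integrable 1 F.
Proof.
move=> cF Gi FG; have mD := pdisk_measurable (1 : R).
have [m1 m2] := measurable_continuousC (r := 1) cF.
split; apply: (le_integrable mD _ _ Gi).
- exact/measurable_EFinP.
- move=> p p1 /=; rewrite lee_fin (le_trans (cRe_le _))// (le_trans (FG p p1))//.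
  exact: ler_norm.
- exact/measurable_EFinP.
- move=> p p1 /=; rewrite lee_fin (le_trans (cIm_le _))// (le_trans (FG p p1))//.
  exact: ler_norm.
Qed.

Lemma sq_integrable_dominated f (G : P -> R) : cont_disk f ->
  dA.-integrable (pdisk 1) (EFin \o G) ->
  (forall p, pdisk 1 p -> normsq f p <= G p) -> sq_integrable f.
Proof.
move=> cf Gi fG; have mD := pdisk_measurable (1 : R).
apply: (le_integrable mD _ _ Gi).
  by apply/measurable_EFinP; exact: measurable_normsq.
move=> p p1 /=; rewrite lee_fin ger0_norm ?normsq_ge0//.
by rewrite (le_trans (fG p p1))// ler_norm.
Qed.

Lemma sq_integrable_lin f g (a b : R) : sq_integrable f -> sq_integrable g ->
  dA.-integrable (pdisk 1) (EFin \o (fun p => a * normsq f p + b * normsq g p)).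
Proof.
move=> fi gi; have mD := pdisk_measurable (1 : R).
apply: eq_integrable (integrableD mD (integrableZl mD a fi) (integrableZl mD b gi)) => //.
Qed.

Lemma inner_integrable f g : cont_disk f -> cont_disk g ->
  sq_integrable f -> sq_integrable g -> disk_integrable 1 (fun z => f z * (g z)^*).
Proof.
move=> cf cg fi gi.
apply: (dominated_disk_integrable _ (sq_integrable_lin 1 1 fi gi)).
  exact: cont_diskM cf (cont_disk_conj cg).
move=> p p1; rewrite cnormM cnorm_conj /normsq.
have := cnorm_ge0 (f (cplx_of_plane p)); have := cnorm_ge0 (g (cplx_of_plane p)).
nra.
Qed.

Lemma innerE (f g : C -> C) : inner f g = disk_integral 1 (fun z => f z * (g z)^*).
Proof. by rewrite /inner plane_diskE. Qed.

Lemma bergmanB (f g : C -> C) : bergman f -> bergman g -> bergman (fun z => f z - g z).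
Proof.
move=> /bergmanP[hf fi] /bergmanP[hg gi]; apply/bergmanP.
have hfg := holB hf hg; split => //.
apply: (sq_integrable_dominated (hol_cont_disk hfg) (sq_integrable_lin 2 2 fi gi)).
move=> p p1; rewrite /normsq.
have := cnormB (f (cplx_of_plane p)) (g (cplx_of_plane p)).
have := cnorm_ge0 (f (cplx_of_plane p) - g (cplx_of_plane p)).
have := cnorm_ge0 (f (cplx_of_plane p)); have := cnorm_ge0 (g (cplx_of_plane p)).
have := sqr_ge0 (cnorm (f (cplx_of_plane p)) - cnorm (g (cplx_of_plane p))).
nra.
Qed.

Lemma bergman_mulX m (f : C -> C) : bergman f -> bergman (fun z => z ^+ m * f z).
Proof.
move=> /bergmanP[hf fi]; apply/bergmanP.
have hfg := holM (@holX R m) hf; split => //.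
apply: (sq_integrable_dominated (hol_cont_disk hfg) (sq_integrable_lin 1 0 fi fi)).
move=> p p1; rewrite /normsq mul0r addr0 mul1r cnormM cnormX exprMn.
by rewrite ler_piMl ?sqr_ge0// !exprn_ile1 ?exprn_ge0 ?cnorm_ge0// ltW.
Qed.

Lemma inner_diff (f g k : C -> C) : bergman f -> bergman g -> bergman k ->
  inner (fun z => f z - g z) k = inner f k - inner g k.
Proof.
move=> /bergmanP[hf fi] /bergmanP[hg gi] /bergmanP[hk ki].
have cf := hol_cont_disk hf; have cg := hol_cont_disk hg; have ck := hol_cont_disk hk.
rewrite !innerE -(disk_integralB (inner_integrable cf ck fi ki) (inner_integrable cg ck
  gi ki)).
by apply: eq_disk_integral => z _; rewrite mulrBl.
Qed.

Lemma inner_diffr (f g k : C -> C) : bergman f -> bergman g -> bergman k ->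
  inner k (fun z => f z - g z) = inner k f - inner k g.
Proof.
move=> /bergmanP[hf fi] /bergmanP[hg gi] /bergmanP[hk ki].
have cf := hol_cont_disk hf; have cg := hol_cont_disk hg; have ck := hol_cont_disk hk.
rewrite !innerE -(disk_integralB (inner_integrable ck cf ki fi) (inner_integrable ck cg
  ki gi)).
by apply: eq_disk_integral => z _; rewrite -mulrBr; congr (_ * _); exact: rmorphB.
Qed.

Lemma eq_inner (f f' g g' : C -> C) : (forall z, cnorm z < 1 -> f z = f' z) ->
  (forall z, cnorm z < 1 -> g z = g' z) -> inner f g = inner f' g'.
Proof.
by move=> ff gg; rewrite !innerE; apply: eq_disk_integral => z z1; rewrite ff ?gg.
Qed.

(** Were [k z] nonzero, continuity would keep [|k|] above half of [|k z|] on a box around [z], and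
    the box has positive area. This turns orthogonality into equality on the disk and so identifies
    the functions chosen by [xget]. *)
Lemma inner_self_eq0 (k : C -> C) : bergman k -> inner k k = 0 -> forall z, cnorm z < 1
  -> k z = 0.
Proof.
move=> /bergmanP[hk ki]; rewrite innerE => kk0 z z1; apply/eqP.
have mD := pdisk_measurable (1 : R).
have I0 : (\int[dA]_(p in pdisk 1) (normsq k p)%:E = 0)%E.
  rewrite -[LHS]fineK ?integrable_fin_num//.
  have := congr1 (@cRe R) kk0; rewrite /disk_integral /= => h.
  congr EFin; rewrite -[RHS]h; apply: eq_Rintegral => p _.
  by rewrite /normsq /= mulr_conjE.
rewrite -cnorm_eq0 eq_le cnorm_ge0 andbT leNgt; apply/negP => kz.
have [e e0 He] := (continuousCP k z).1 (hol_continuous hk z1) _ (divr_gt0 kz (ltr0Sn R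
  1)).
(* Points of the box with half-side [s] are at distance less than [2 s] from [z]; both minima ensure
   that this stays within [e] and within the unit disk. *)
set s := Num.min (e / 2) ((1 - cnorm z) / 2).
have s0 : 0 < s by rewrite lt_min !divr_gt0// subr_gt0.
have se : s <= e / 2 by rewrite ge_min lexx.
have sz : s <= (1 - cnorm z) / 2 by rewrite ge_min lexx orbT.
pose B : set P := `]cRe z - s, cRe z + s[ `*` `]cIm z - s, cIm z + s[.
have mB : measurable B by apply: measurableX; exact: measurable_itv.
have Bz p : B p -> cnorm (cplx_of_plane p - z) < s * 2.
  move=> [] /=; rewrite !in_itv/= => /andP[a1 a2] /andP[b1 b2].
  rewrite (le_lt_trans (cnorm_le _))// cReB cImB /cplx_of_plane {1}/cRe {2}/cIm /=.
  rewrite mulr_natr mulr2n ltrD// ltr_norml; lra.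
have BD : B `<=` pdisk 1.
  move=> p /Bz h; rewrite /pdisk /=.
  have := cnormD (cplx_of_plane p - z) z; rewrite subrK; lra.
have kB p : B p -> (cnorm (k z) / 2) ^+ 2 <= normsq k p.
  move=> /Bz h; have := He (cplx_of_plane p); move=> /(_ (lt_le_trans h _)).
  have -> : s * 2 <= e by lra.
  move=> /(_ isT) h2; rewrite /normsq ler_pXn2r ?nnegrE ?cnorm_ge0 ?divr_ge0 ?cnorm_ge0//.
  have := cnormD (k z - k (cplx_of_plane p)) (k (cplx_of_plane p)).
  rewrite subrK cdistC; lra.
have msq : measurable_fun (pdisk 1) (EFin \o normsq k) := measurable_int _ ki.
have H1 : (((cnorm (k z) / 2) ^+ 2)%:E * dA B <= 0)%E.
  rewrite -I0 -integral_cst//.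
  apply: (@le_trans _ _ (\int[dA]_(p in B) (normsq k p)%:E)%E).
    apply: ge0_le_integral => //.
      by move=> p _; rewrite lee_fin sqr_ge0.
    exact: measurable_funS msq.
  apply: ge0_subset_integral => //.
  by move=> p _; rewrite lee_fin normsq_ge0.
have H2 : dA B = ((pi : R)^-1 * ((s * 2) * (s * 2)))%:E.
  have -> : dA B = ((pi : R)^-1%:E * (product_measure1 (@lebesgue_measure R)
    (@lebesgue_measure R)) B)%E by [].
  rewrite product_measure1E//= !lebesgue_measure_itv/= !lte_fin.
  have l1 : cRe z - s < cRe z + s by lra.
  have l2 : cIm z - s < cIm z + s by lra.
  rewrite l1 l2 -!EFinB -!EFinM; congr EFin; congr (_ * _).
  by ring.
move: H1; rewrite H2 -EFinM lee_fin leNgt => /negP; apply.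
by rewrite !mulr_gt0 ?exprn_gt0 ?invr_gt0 ?pi_gt0// divr_gt0.
Qed.

(** * Exhaustion of the unit disk by smaller disks *)

Definition exh_radius (n : nat) : R := 1 - n.+2%:R^-1.

(** The index shift by 2 makes the first radius 1/2. Powers of the radii are then bounded below
    uniformly in [n], as the estimate of the norm of h requires. *)
Lemma exh_radius_half n : 1 / 2 <= exh_radius n.
Proof.
rewrite /exh_radius; have : n.+2%:R^-1 <= 2^-1 :> R by rewrite lef_pV2 ?posrE// ler_nat.
by set x := _^-1 => ?; rewrite div1r; lra.
Qed.

Lemma exh_radius_lt1 n : exh_radius n < 1.
Proof. by rewrite /exh_radius ltrBlDr ltrDl invr_gt0. Qed.

Lemma exh_radius_gt0 n : 0 < exh_radius n.
Proof. by rewrite (lt_le_trans _ (exh_radius_half n))// divr_gt0. Qed.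

Lemma exh_radius_cvg : exh_radius n @[n --> \oo] --> (1 : R).
Proof.
rewrite -[X in _ --> X]subr0; apply: cvgB; first exact: cvg_cst.
have := @cvg_harmonic R; rewrite -(@cvg_shiftS _ (@harmonic R)).
exact.
Qed.

Lemma exh_radius_near x : x < 1 -> \forall n \near \oo, x < exh_radius n.
Proof. by move=> x1; exact: (cvgr_gt _ exh_radius_cvg). Qed.

Lemma pdisk_radius_sub n : pdisk (exh_radius n) `<=` pdisk 1.
Proof. by move=> p h; exact: lt_trans h (exh_radius_lt1 n). Qed.

(** Dominated convergence for the extensions of [f] by zero, with [|f|] as the dominating
    function. *)
Lemma disk_exhaustion_cvg (f : P -> R) : dA.-integrable (pdisk 1) (EFin \o f) ->
  Rintegral dA (pdisk (exh_radius n)) f @[n --> \oo] --> Rintegral dA (pdisk 1) f.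
Proof.
move=> fi; have mD := pdisk_measurable (1 : R).
have mf := measurable_int _ fi.
pose f_ n := (EFin \o (f \_ (pdisk (exh_radius n)))).
have mf' : measurable_fun (pdisk 1) f by apply/measurable_EFinP.
have [|||||_ _ H] := @dominated_convergence _ _ _ dA (pdisk 1) mD f_ (EFin \o f) (EFin
  \o (fun p => `|f p|)).
- move=> n; apply/measurable_EFinP.
  apply/(measurable_restrict _ (pdisk_measurable _) mD).
  exact: measurable_funS mf'.
- exact: mf.
- apply: aeW => p p1.
  apply: cvg_near_cst; near=> n.
  rewrite /f_ /= patchE ifT//; apply/mem_set; near: n.
  exact: exh_radius_near p1.
- exact: integrable_norm fi.
- apply: aeW => p n p1; rewrite /f_ /= lee_fin patchE.
  by case: ifPn => // _; rewrite normr0.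
have -> : (fun n => Rintegral dA (pdisk (exh_radius n)) f) =
    (fun n => fine (\int[dA]_(p in pdisk 1) f_ n p)%E).
  apply/funext => n; rewrite -(setIidr (@pdisk_radius_sub n)).
  by rewrite Rintegral_mkcondr.
apply: fine_cvg; rewrite fineK//; exact: integrable_fin_num.
Unshelve. all: by end_near. Qed.

(** Integrability is the conclusion here, so the passage to the limit is by monotone convergence of
    the nonnegative squared modulus over increasing disks. *)
Lemma sq_integrable_exhaustion (h : C -> C) (M : R) : cont_disk h ->
  (forall n, Rintegral dA (pdisk (exh_radius n)) (normsq h) <= M) -> sq_integrable h.
Proof.
move=> ch hM; have mD := pdisk_measurable (1 : R).
have mh := measurable_normsq ch.
apply/integrableP; split; first exact/measurable_EFinP.
have -> : (\int[dA]_(p in pdisk 1) `|(EFin \o normsq h) p|)%E =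
    (\int[dA]_(p in pdisk 1) (normsq h p)%:E)%E.
  by apply: eq_integral => p _ /=; rewrite ger0_norm// normsq_ge0.
have UE : pdisk 1 = \bigcup_n pdisk (exh_radius n) :> set P.
  apply/seteqP; split => [p p1|p [n _]]; last exact: pdisk_radius_sub.
  have [n _ Hn] := exh_radius_near p1.
  by exists n => //; apply: Hn => /=.
have cvgI := @ge0_nondecreasing_set_cvg_integral _ _ _ (fun n => pdisk (exh_radius n))
  (EFin \o normsq h) dA.
have {}cvgI : (\int[dA]_(p in pdisk (exh_radius n)) (normsq h p)%:E)%E @[n --> \oo] -->
    (\int[dA]_(p in pdisk 1) (normsq h p)%:E)%E.
  rewrite UE; apply: cvgI.
  - move=> n k nk; apply/subsetPset => p; rewrite /pdisk /= => /lt_le_trans; apply.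
    by rewrite /exh_radius lerD2l lerN2 lef_pV2 ?posrE// ler_nat.
  - by move=> n; exact: pdisk_measurable.
  - move=> n; apply/measurable_EFinP; apply: measurable_funS mh => //.
    exact: pdisk_radius_sub.
  - by move=> n p _; rewrite lee_fin normsq_ge0.
apply: (@le_lt_trans _ _ M%:E); last by rewrite ltry.
rewrite -(cvg_lim _ cvgI)//; apply: lime_le; first by apply/cvg_ex; eexists; exact: cvgI.
near=> n.
have ci : cont_disk (fun z => h z * (h z)^*) := cont_diskM ch (cont_disk_conj ch).
have [fi _] := cont_disk_integrable (exh_radius_lt1 n) ci.
have {}fi : dA.-integrable (pdisk (exh_radius n)) (EFin \o normsq h).
  apply: eq_integrable fi; first exact: pdisk_measurable.
  by move=> p _; rewrite /= mulr_conjE.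
rewrite -[leLHS]fineK ?integrable_fin_num//; first by rewrite lee_fin; exact: hM.
exact: pdisk_measurable.
Unshelve. all: by end_near. Qed.

End Bergman.

(** * The adjoint of multiplication by a power of z *)

Section Adjoint.
Variable R : realType.
Local Notation C := (Cplx R).
Local Notation P := (plane R).
Local Notation dA := (@dA R).

Lemma normsq_integrable_radius (f : C -> C) (r : R) : r < 1 -> cont_disk f ->
  dA.-integrable (pdisk r) (EFin \o normsq f).
Proof.
move=> r1 cf; have [fi _] := cont_disk_integrable r1 (cont_diskM cf (cont_disk_conj cf)).
by apply: eq_integrable fi => [|p _]; [exact: pdisk_measurable|rewrite /= mulr_conjE].
Qed.

Lemma cRe_disk_integral_normsq (f : C -> C) (r : R) :
  cRe (disk_integral r (fun z => f z * (f z)^*)) = Rintegral dA (pdisk r) (normsq f).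
Proof. by apply: eq_Rintegral => p _; rewrite /= mulr_conjE. Qed.

(** On a disk of radius [r < 1], where [h] is bounded, [disk_adjoint_identity] with [f = h] gives
    [c \int |h|^2 = Re \int z^m h conj(g)] for [c = r^(2m)]. The right side is at most
    [\int |h| |g|], and the inequality [|h| |g| <= c/2 |h|^2 + 1/(2c) |g|^2] lets half of the left
    side be absorbed, leaving [c^2 \int |h|^2 <= \int |g|^2]. *)
Lemma sq_integrable_adj_fun m (q : C -> C) : hol q ->
  sq_integrable (fun z => z ^+ m * q z) -> sq_integrable (adj_fun m q).
Proof.
move=> hq gi; set g := fun z => _ in gi.
have hh := hol_adj_fun m hq; set h := adj_fun m q in hh *.
have hg : hol g := holM (@holX R m) hq.
have ch := hol_cont_disk hh; have cg := hol_cont_disk hg.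
have cXm : cont_disk (fun z : C => z ^+ m) by apply: hol_cont_disk; exact: holX.
set J := Rintegral dA (pdisk 1) (normsq g).
(* A lower bound for [r^(2m)] valid for every radius of the exhaustion. *)
pose c0 : R := (1 / 2) ^+ (2 * m).
apply: (@sq_integrable_exhaustion _ _ (J / c0 ^+ 2)) => // n.
set r := exh_radius R n; have r0 : 0 < r := @exh_radius_gt0 R n;
  have r1 : r < 1 := @exh_radius_lt1 R n.
have mD := pdisk_measurable r.
set c := r ^+ (2 * m).
have c_gt0 : 0 < c by rewrite exprn_gt0.
have c00 : 0 < c0 by rewrite exprn_gt0// divr_gt0.
have c0c : c0 <= c.
  by apply: lerXn2r; rewrite ?nnegrE ?divr_ge0 ?exh_radius_half// ltW.
have hi := normsq_integrable_radius r1 ch; have gir := normsq_integrable_radius r1 cg.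
set I := Rintegral dA (pdisk r) (normsq h); set Jr := Rintegral dA (pdisk r) (normsq g).
have JrJ : Jr <= J.
  apply: fine_le; rewrite ?integrable_fin_num//; first exact: pdisk_measurable.
  apply: ge0_subset_integral => //.
  - exact: pdisk_measurable.
  - exact: measurable_int gi.
  - by move=> p _; rewrite lee_fin normsq_ge0.
  - exact: pdisk_radius_sub.
have key : c * I <= c / 2 * I + 1 / (2 * c) * Jr.
  have := congr1 (@cRe R) (disk_adjoint_identity m hh hq r0 r1).
  rewrite -/h cReM cRe_real cIm_real mul0r subr0 cRe_disk_integral_normsq -/I -/c => <-.
  rewrite /I /Jr -!RintegralZl//.
  have Z (a : R) (f : P -> R) : dA.-integrable (pdisk r) (EFin \o f) ->
      dA.-integrable (pdisk r) (EFin \o (fun p => a * f p)).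
    by move=> fi; apply: eq_integrable (integrableZl mD a fi) => // p _ /=; rewrite EFinM.
  have Zh := Z (c / 2) _ hi; have Zg := Z (1 / (2 * c)) _ gir.
  rewrite -RintegralD//.
  apply: le_Rintegral => //.
  - have [] := cont_disk_integrable r1 (cont_diskM (cont_diskM cXm ch) (cont_disk_conj
    cg)).
    by [].
  - by apply: eq_integrable (integrableD mD Zh Zg).
  move=> p pr; rewrite /= (le_trans (ler_norm _))// (le_trans (cRe_le _))//.
  set z := cplx_of_plane p; have z0 := cnorm_ge0 z.
  rewrite -/(g z) (cnormM (z ^+ m * h z)) cnorm_conj (cnormM (z ^+ m)) cnormX.
  have zm : cnorm z ^+ m <= 1 by rewrite exprn_ile1// ltW// (lt_trans pr).
  have zm0 : 0 <= cnorm z ^+ m by rewrite exprn_ge0.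
  set a := cnorm (h z); set b := cnorm (g z).
  have a0 : 0 <= a := cnorm_ge0 _; have b0 : 0 <= b := cnorm_ge0 _.
  apply: (@le_trans _ _ (a * b)); first by rewrite ler_wpM2r// ler_piMl.
  (* The difference of the two sides of the weighted inequality is a square divided by [2 c]. *)
  have -> : c / 2 * a ^+ 2 + 1 / (2 * c) * b ^+ 2 = ((c * a - b) ^+ 2) / (2 * c) + a * b.
    by field; rewrite gt_eqF.
  by rewrite lerDr divr_ge0 ?sqr_ge0 ?mulr_ge0 ?ltW.
have I0 : 0 <= I by apply: Rintegral_ge0 => p _; exact: normsq_ge0.
have J0 : 0 <= Jr by apply: Rintegral_ge0 => p _; exact: normsq_ge0.
have cI : c ^+ 2 * I <= Jr.
  have : c / 2 * I <= 1 / (2 * c) * Jr by lra.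
  have c2 : 0 < 2 * c by rewrite mulr_gt0.
  move=> /(ler_wpM2l (ltW c2)).
  have -> : 2 * c * (c / 2 * I) = c ^+ 2 * I by field.
  have -> : 2 * c * (1 / (2 * c) * Jr) = Jr by field; rewrite gt_eqF.
  by [].
rewrite ler_pdivlMr ?exprn_gt0//.
apply: le_trans JrJ; apply: le_trans cI; rewrite mulrC ler_wpM2r//.
by apply: lerXn2r; rewrite ?nnegrE// ltW.
Qed.

(** Both integrals converge along the exhaustion while the factor tends to 1, so uniqueness of
    limits removes it. *)
Lemma disk_integral_exhaustion_eq k (F G : C -> C) :
  disk_integrable 1 F -> disk_integrable 1 G ->
  (forall n, disk_integral (exh_radius R n) F =
    cplx_of_real (exh_radius R n ^+ k) * disk_integral (exh_radius R n) G) ->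
  disk_integral 1 F = disk_integral 1 G.
Proof.
move=> [F1 F2] [G1 G2] FG.
have ck : exh_radius R n ^+ k @[n --> \oo] --> (1 : R).
  rewrite -(expr1n R k).
  exact: (@cvg_comp _ _ _ _ (fun x : R => x ^+ k) _ _ _ (@exh_radius_cvg R)
    (@exprn_continuous _ k 1)).
have lim_eq (f g : P -> R) : dA.-integrable (pdisk 1) (EFin \o f) ->
    dA.-integrable (pdisk 1) (EFin \o g) ->
    (forall n, Rintegral dA (pdisk (exh_radius R n)) f =
      exh_radius R n ^+ k * Rintegral dA (pdisk (exh_radius R n)) g) ->
    Rintegral dA (pdisk 1) f = Rintegral dA (pdisk 1) g.
  move=> fi gi fg.
  have H1 := disk_exhaustion_cvg fi.
  have H2 : exh_radius R n ^+ k * Rintegral dA (pdisk (exh_radius R n)) g @[n --> \oo] -->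
      Rintegral dA (pdisk 1) g.
    by rewrite -[X in _ --> X]mul1r; apply: cvgM => //; exact: disk_exhaustion_cvg.
  have FE : (fun n => Rintegral dA (pdisk (exh_radius R n)) f) =
      (fun n => exh_radius R n ^+ k * Rintegral dA (pdisk (exh_radius R n)) g).
    by apply/funext => n; exact: fg.
  rewrite FE in H1.
  exact: (cvg_unique (@Rhausdorff R) H1 H2).
apply: cplxP; apply: lim_eq => // n.
  by have := congr1 (@cRe R) (FG n); rewrite cReM cRe_real cIm_real mul0r subr0.
by have := congr1 (@cIm R) (FG n); rewrite cImM cRe_real cIm_real mul0r addr0.
Qed.

Lemma inner_adj_fun m (f q : C -> C) : bergman f -> hol q ->
  bergman (fun z => z ^+ m * q z) ->
  inner (fun z => z ^+ m * f z) (fun z => z ^+ m * q z) = inner f (adj_fun m q).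
Proof.
move=> bf hq bg; have /bergmanP[hg gi] := bg.
have /bergmanP[hf fi] := bf; have /bergmanP[hmf mfi] := bergman_mulX m bf.
have hh := hol_adj_fun m hq; have hi := sq_integrable_adj_fun hq gi.
rewrite !innerE; apply: (@disk_integral_exhaustion_eq (2 * m)).
- exact: (inner_integrable (hol_cont_disk hmf) (hol_cont_disk hg) mfi gi).
- exact: (inner_integrable (hol_cont_disk hf) (hol_cont_disk hh) fi hi).
- by move=> n; apply: disk_adjoint_identity => //;
  [exact: exh_radius_gt0|exact: exh_radius_lt1].
Qed.

(** The product [z^m f] already lies in the Bergman space and is a candidate for its own projection.
    Its difference from the chosen candidate is a Bergman function orthogonal to every Bergman
    function, in particular to itself; hence the equality on the disk. *)
Lemma toeplitz_mulX m (f : C -> C) : bergman f ->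
  bergman (toeplitz (fun w => w ^+ m) f) /\
  forall z, cnorm z < 1 -> toeplitz (fun w => w ^+ m) f z = z ^+ m * f z.
Proof.
move=> bf; have bm := bergman_mulX m bf.
set T := toeplitz _ f.
have [bT TO] : [set h : C -> C | bergman h /\
    forall k, bergman k -> inner (fun z => z ^+ m * f z - h z) k = 0] T.
  rewrite /T /toeplitz /bergman_proj; apply: xgetPex; exists (fun z => z ^+ m * f z).
  by split=> // k bk; rewrite inner_diff// subrr.
split=> // z z1; apply/eqP; rewrite eq_sym -subr_eq0; apply/eqP.
have bd := bergmanB bm bT.
exact: (inner_self_eq0 bd (TO _ bd) z1).
Qed.

(** The function [adj_fun m q] satisfies the adjoint relation and has finite norm, so it is a
    candidate for [adjoint]. Testing both candidates against their difference shows that this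
    difference has norm zero. *)
Lemma adjoint_toeplitz_mulX m (g q : C -> C) z : bergman g -> hol q ->
  (forall w, cnorm w < 1 -> g w = w ^+ m * q w) -> cnorm z < 1 ->
  adjoint (toeplitz (fun w => w ^+ m)) g z = adj_fun m q z.
Proof.
move=> bg hq gq z1.
have /bergmanP[hg gi] := bg.
have bzq : bergman (fun w => w ^+ m * q w).
  apply/bergmanP; have [hzq _] := hol_ext gq hg; split => //.
  by apply: eq_integrable gi => [|p]; [exact: pdisk_measurable|rewrite inE => p1 /=;
    rewrite /normsq gq].
have bh : bergman (adj_fun m q).
  apply/bergmanP; split; first exact: hol_adj_fun.
  by apply: sq_integrable_adj_fun => //; case/bergmanP: bzq.
set A := adjoint _ g.
have hadj f : bergman f -> inner (toeplitz (fun w => w ^+ m) f) g = inner f (adj_fun m q).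
  move=> bf; rewrite -inner_adj_fun//; apply: eq_inner => // w w1.
  by have [_ ->] := toeplitz_mulX m bf.
have [bA AO] : [set h : C -> C | bergman h /\
    forall f, bergman f -> inner (toeplitz (fun w => w ^+ m) f) g = inner f h] A.
  by rewrite /A /adjoint; apply: xgetPex; exists (adj_fun m q).
have bd := bergmanB bA bh.
apply/eqP; rewrite -subr_eq0; apply/eqP.
apply: (inner_self_eq0 bd _ z1).
by rewrite inner_diffr// -AO// hadj// subrr.
Qed.

End Adjoint.

Theorem lemma2p2 (R : realType) (m : nat) (hm : (1 <= m)%N)
    (g : Cplx R -> Cplx R) (hg : bergman g)
    (hg0 : forall k : nat, (k < m)%N -> derive1n k g 0 = 0)
    (z : Cplx R) (hz : disk z) (hz0 : z != 0) :
  adjoint (toeplitz (fun w => w ^+ m)) g z =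
    (z ^+ m.+1)^-1 *
      segment_integral (fun w => w * derive1 g w - (m%:R - 1) * g w) z
  /\
  (z ^+ m.+1)^-1 *
      segment_integral (fun w => w * derive1 g w - (m%:R - 1) * g w) z =
    (z ^+ m)^-1 * g z - m%:R / z ^+ m.+1 * segment_integral g z.
Proof.
have z1 : cnorm z < 1 by exact/diskE.
have /bergmanP[holg _] := hg.
have [q hq gq] := hol_factor holg hg0.
rewrite (segment_integral_by_parts _ holg z1).
rewrite (adjoint_toeplitz_mulX hg hq gq z1).
(* After substituting [g = z^m q] and the integral [z^(m+1) S], both claims are rational identities
   in [z], [z^m], [q z] and [S]; splitting [z^(m+1)] leaves only [z] and [z^m] as denominators. *)
rewrite (segment_integral_factor gq hq z1) (gq z z1) /adj_fun exprS.
have zm : z ^+ m != 0 by rewrite expf_neq0.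
by split; field; rewrite ?hz0 ?zm.
Qed.
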